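(* Let $n\ge2$ and let $I\subseteq[n-1]$ be non-empty. Then, for complex $s_0$ and $s_\iota$ ($\iota\in I$) with sufficiently large real parts, $$\Xi_{n,I}\bigl(s_0,(s_\iota)_{\iota\in I}\bigr)=\frac{q^{-\sum_{\iota\in I}\iota(s_\iota-n+\iota)}}{(1-q^{-1})^{|I|+1}}\sum_{E\in\mathrm{L}_I(\mathfrak{o}/\mathfrak{m})}\tau_{I,E}\int\limits_{\substack{(x_0,(x_\iota)_{\iota\in I},B)\in\mathscr{M}_I\\ \overline{B}=E}}|x_0|^{s_0n-1}\prod_{\iota\in I}|x_\iota|^{\iota(s_\iota-(n-\iota))-1}\,|d\mathbf{x}|\,|dB|,$$ where $\mathscr{M}_I\subseteq\mathfrak{o}\times\mathfrak{o}^I\times\mathrm{L}_I(\mathfrak{o})$ is the set of tuples $(x_0,(x_\iota)_{\iota\in I},B)$ satisfying $$\prod_{\substack{\iota\in I\\ j\le\iota<i}}\pi x_\iota\ \Big|\ x_0\Bigl(\prod_{\substack{\iota\in I\\ i'\le\iota}}\pi x_\iota\Bigr)\Bigl(\sum_{k\le i}B_{ik}B_{i'k}(B^{-1})_{kj}\Bigr)\qquad\text{for all }(j,i,i')\in[n]^3\text{ with }j<i\le i'.$$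
   Context: $\mathfrak{o}$ is a compact discrete valuation ring with maximal ideal $\mathfrak{m}=\pi\mathfrak{o}$, $q=\#(\mathfrak{o}/\mathfrak{m})$, and $|x|=q^{-v(x)}$ with $v$ the $\mathfrak{m}$-adic valuation. $[n]=\{1,\dots,n\}$, $\mathbb{N}=\{1,2,\dots\}$, $\mathbb{N}_0=\mathbb{N}\cup\{0\}$. $\mathfrak{o}^n$ carries componentwise multiplication; $\Lambda\le_s\mathfrak{o}^n$ means that $\Lambda$ is a finite-index $\mathfrak{o}$-submodule closed under multiplication. For non-empty $I=\{i_1<\dots<i_\ell\}\subseteq[n-1]$ and $(r_0,\mathbf{r})\in\mathbb{N}_0\times\mathbb{N}^I$, let $D(I,\mathbf{r})$ be the diagonal $n\times n$ matrix with $i$-th diagonal entry $\pi^{\sum_{\iota\in I,\iota\ge i}r_\iota}$; for a matrix $M$, $\langle M\rangle$ is the submodule generated by its rows. Write $\nu_0(\Lambda)=(I,r_0,\mathbf{r})$ if $\Lambda=\langle\pi^{r_0}D(I,\mathbf{r})A\rangle$ for some $A\in\mathrm{GL}_n(\mathfrak{o})$, set $h_n(I,r_0,\mathbf{r})=\#\{\Lambda\le_s\mathfrak{o}^n:\nu_0(\Lambda)=(I,r_0,\mathbf{r})\}$, and define $$\Xi_{n,I}\bigl(s_0,(s_\iota)_{\iota\in I}\bigr)=\sum_{(r_0,\mathbf{r})\in\mathbb{N}_0\times\mathbb{N}^I}q^{-s_0nr_0-\sum_{\iota\in I}r_\iota\,\iota\,s_\iota}\,h_n(I,r_0,\mathbf{r}).$$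 Put $i_0=0$, $i_{\ell+1}=n$. For a commutative ring $R$, $\mathrm{L}_I(R)$ is the group of block lower-triangular matrices in $\mathrm{GL}_n(R)$, for the block sizes $i_1,i_2-i_1,\dots,n-i_\ell$, whose diagonal blocks are identity matrices and whose blocks below the diagonal are arbitrary. $|dB|$ is the normalized Haar measure on $\mathrm{L}_I(\mathfrak{o})$ (equivalently, the product of normalized additive Haar measures of $\mathfrak{o}$ over the entries below the block diagonal), $|d\mathbf{x}|$ is the normalized Haar measure on $\mathfrak{o}\times\mathfrak{o}^I$, and $\overline{B}$ is reduction modulo $\mathfrak{m}$. For $E\in\mathrm{L}_I(\mathfrak{o}/\mathfrak{m})$, $\tau_{I,E}=\#\{\sigma\in\mathbb{S}_n:E\sigma\in\mathcal{R}_I(\mathfrak{o}/\mathfrak{m})\}$, where $E\sigma$ is obtained from $E$ by permuting its columns according to $\sigma$, and $\mathcal{R}_I(\mathfrak{o}/\mathfrak{m})$ is the set of $A\in\mathrm{GL}_n(\mathfrak{o}/\mathfrak{m})$ such that (1) in each row the leftmost nonzero entry is $1$ (the leading $1$ of the row); (2) all entries above a leading $1$ are zero; (3) for each $j=0,\dots,\ell$, the leading $1$'s in rows $i_j+1,\dots,i_{j+1}$ occur in strictly increasing column positions. *)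

(* Defs.v *)
From HB Require Import structures.
From mathcomp Require Import all_boot all_order all_algebra all_fingroup.
From mathcomp Require Import finmap complex.
From mathcomp Require Import all_classical all_reals all_analysis.

Set Implicit Arguments.
Unset Strict Implicit.
Unset Printing Implicit Defensive.

Import Order.TTheory GRing.Theory Num.Theory.

Local Open Scope classical_set_scope.
Local Open Scope ring_scope.

#[short(type="topIdomainType")]
HB.structure Definition TopIdomain :=
  {T of Topological T & GRing.IntegralDomain T}.

Definition rdivides (A : comNzRingType) (a b : A) : Prop :=
  exists c, b = c * a.

Definition is_ideal (A : comNzRingType) (J : set A) : Prop :=
  [/\ J 0, (forall x y, J x -> J y -> J (x + y))
    & (forall a x, J x -> J (a * x))].

(* A principal ideal domain which is local with maximal ideal (pi) and is not
   a field. *)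
Definition is_dvr (A : idomainType) (pi : A) : Prop :=
  [/\ (forall J : set A, is_ideal J -> exists a, J = [set x | rdivides a x]),
      (forall x, x \isn't a GRing.unit <-> rdivides pi x)
    & pi != 0].

Record is_compact_dvr (o : topIdomainType) (pi : o) : Prop := IsCompactDvr {
  cdvr_dvr : is_dvr pi;
  cdvr_adic : forall (x : o) (U : set o),
    nbhs x U <-> exists k : nat, forall y, U (x + pi ^+ k * y);
  cdvr_compact : compact [set: o] }.

(* red : o -> k exhibits k as o / (pi). *)
Record is_residue_map (o : topIdomainType) (pi : o) (k : finFieldType)
    (red : {rmorphism o -> k}) : Prop := IsResidueMap {
  residue_surj : forall a, exists x, red x = a;
  residue_ker : forall x, red x = 0 <-> rdivides pi x }.

Section AbsoluteValue.
Variables (R : realType) (o : idomainType) (pi : o) (q : nat).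

(* pi-adic valuation of x; only meaningful for x != 0. *)
Definition vald (x : o) : nat :=
  xget 0%N [set k | rdivides (pi ^+ k) x /\ ~ rdivides (pi ^+ k.+1) x].

Definition absd (x : o) : R := if x == 0 then 0 else q%:R^-1 ^+ vald x.

End AbsoluteValue.

Section ComplexAnalysis.
Variable R : realType.

(* a ^ s for real a >= 0 and complex s, with 0 ^ s = 0. *)
Definition cpow (a : R) (s : R[i]) : R[i] :=
  if a == 0 then 0 else
  Complex (expR (complex.Re s * ln a) * cos (complex.Im s * ln a))
          (expR (complex.Re s * ln a) * sin (complex.Im s * ln a)).

Definition rsum (T : choiceType) (D : set T) (f : T -> R) : R :=
  fine (\esum_(t in D) (Num.max (f t) 0)%:E)
  - fine (\esum_(t in D) (Num.max (- f t) 0)%:E).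

Definition csum (T : choiceType) (D : set T) (f : T -> R[i]) : R[i] :=
  Complex (rsum D (fun t => complex.Re (f t)))
          (rsum D (fun t => complex.Im (f t))).

Definition csummable (T : choiceType) (D : set T) (f : T -> R[i]) : Prop :=
  summable D (fun t => (complex.Re (f t))%:E) /\
  summable D (fun t => (complex.Im (f t))%:E).

Section Integral.
Variables (d : measure_display) (T : measurableType d).
Variable mu : {measure set T -> \bar R}.

Definition cintegral (D : set T) (f : T -> R[i]) : R[i] :=
  Complex (\int[mu]_(t in D) complex.Re (f t))
          (\int[mu]_(t in D) complex.Im (f t)).

Definition cintegrable (D : set T) (f : T -> R[i]) : Prop :=
  mu.-integrable D (fun t => (complex.Re (f t))%:E) /\
  mu.-integrable D (fun t => (complex.Im (f t))%:E).

End Integral.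

(* mu is concentrated on G and invariant under op g for g in G. When G is a
   compact group under op, this is the normalized Haar measure of G, seen as a
   measure on the ambient space T. *)
Definition is_haar (d : measure_display) (T : measurableType d)
    (op : T -> T -> T) (G : set T) (mu : probability T R) : Prop :=
  mu G = 1%E /\
  forall (g : T) (U : set T), G g -> measurable U -> mu (op g @^-1` U) = mu U.

End ComplexAnalysis.

Definition borel (T : ptopologicalType) := g_sigma_algebraType (@open T).

(* I is a subset of {1, ..., n-1}, given as a subset of 'I_n that avoids 0; its
   elements stand for their own values. Row and column indices, on the other
   hand, are shifted to start from 0, so that for a row index i and iota in I
   the usual conditions i <= iota and iota < i become i < iota and
   iota <= i. *)
Definition Idx (n : nat) (I : {set 'I_n}) := {i : 'I_n | i \in I}.

Definition inat (n : nat) (I : {set 'I_n}) (i : Idx I) : nat := val (val i).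

Section Lattices.
Variables (n : nat) (o : topIdomainType) (pi : o) (I : {set 'I_n}).

Definition is_subalgebra (L : set 'rV[o]_n) : Prop :=
  [/\ L 0,
      (forall a u v, L u -> L v -> L (a *: u + v)),
      finite_set [set [set u + v | v in L] | u in [set: 'rV[o]_n]]
    & (forall u v, L u -> L v -> L (map2_mx *%R u v))].

Definition rowspan (M : 'M[o]_n) : set 'rV[o]_n :=
  [set v *m M | v in [set: 'rV[o]_n]].

Definition Dmx (r : {ffun Idx I -> nat}) : 'M[o]_n :=
  diag_mx (\row_i pi ^+ (\sum_(iota : Idx I | (i < inat iota)%N) r iota)).

Definition has_type (L : set 'rV[o]_n) (r0 : nat) (r : {ffun Idx I -> nat}) :=
  exists2 A : 'M[o]_n, A \in unitmx & L = rowspan (pi ^+ r0 *: (Dmx r *m A)).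

Definition hcount (r0 : nat) (r : {ffun Idx I -> nat}) : nat :=
  #|` fset_set [set L | is_subalgebra L /\ has_type L r0 r]|%fset.

Definition Xi_term (R : realType) (q : nat) (s0 : R[i]) (s : Idx I -> R[i])
    (t : nat * {ffun Idx I -> nat}) : R[i] :=
  cpow q%:R (- (s0 * n%:R * t.1%:R)
             - \sum_(iota : Idx I) (t.2 iota)%:R * (inat iota)%:R * s iota)
  * (hcount t.1 t.2)%:R.

Definition Xi_dom : set (nat * {ffun Idx I -> nat}) :=
  [set t : nat * {ffun Idx I -> nat} | forall iota, (0 < t.2 iota)%N].

Definition Xi (R : realType) (q : nat) (s0 : R[i]) (s : Idx I -> R[i]) : R[i] :=
  csum Xi_dom (Xi_term q s0 s).

End Lattices.

Section Blocks.
Variables (n : nat) (I : {set 'I_n}).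

(* The j such that i_j <= i < i_(j+1), for I = {i_1 < i_2 < ...}. *)
Definition blk (i : 'I_n) : nat := #|[pred iota in I | (iota <= i)%N]|.

Definition in_L (A : comUnitRingType) (B : 'M[A]_n) : bool :=
  (B \in unitmx) &&
  [forall i, forall j, (blk i <= blk j)%N ==> (B i j == (i == j)%:R)].

Section Residue.
Variable k : finFieldType.

Definition leading (A : 'M[k]_n) (i c : 'I_n) : bool :=
  (A i c != 0) && [forall c' : 'I_n, (c' < c)%N ==> (A i c' == 0)].

Definition in_RI (A : 'M[k]_n) : bool :=
  [&& A \in unitmx,
      [forall i, forall c, leading A i c ==> (A i c == 1)],
      [forall i, forall c, leading A i c ==>
        [forall i' : 'I_n, (i' < i)%N ==> (A i' c == 0)]]
    & [forall i, forall i', forall c, forall c',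
        [&& blk i == blk i', (i < i')%N, leading A i c & leading A i' c']
        ==> (c < c')%N]].

Definition tau (E : 'M[k]_n) : nat := #|[pred s : 'S_n | in_RI (col_perm s E)]|.

End Residue.

Section Integration.
Variables (o : topIdomainType) (pi : o).

(* o x o^I with the product topology. The base points are only there because
   measurable types have one. *)
Definition Xtop : Type :=
  (o * prod_topology (fun _ : Idx I => (o : topologicalType)))%type.
HB.instance Definition _ := Topological.on Xtop.
HB.instance Definition _ := isPointed.Build Xtop (0, fun=> 0).
Definition Xspace := borel Xtop.

Definition Btop : Type := 'M[o]_n.
HB.instance Definition _ := Topological.on Btop.
HB.instance Definition _ := isPointed.Build Btop (0 : 'M[o]_n).
Definition Bspace := borel Btop.

Definition Xadd (x y : Xspace) : Xspace :=
  (x.1 + y.1, fun iota => x.2 iota + y.2 iota).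

Definition Bmul (B C : Bspace) : Bspace := (B : 'M[o]_n) *m C.

Definition in_M (x0 : o) (x : Idx I -> o) (B : 'M[o]_n) : Prop :=
  in_L B /\
  forall j i i' : 'I_n, (j < i)%N -> (i <= i')%N ->
    rdivides
      (\prod_(iota : Idx I | (j < inat iota <= i)%N) (pi * x iota))
      (x0 * (\prod_(iota : Idx I | (i' < inat iota)%N) (pi * x iota))
       * (\sum_(l < n | (l <= i)%N) B i l * B i' l * invmx B l j)).

Definition M_fiber (k : finFieldType) (red : {rmorphism o -> k})
    (E : 'M[k]_n) : set (Xspace * Bspace) :=
  [set z | in_M z.1.1 z.1.2 z.2 /\ map_mx red (z.2 : 'M[o]_n) = E].

Definition integrand (R : realType) (q : nat) (s0 : R[i]) (s : Idx I -> R[i])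
    (z : Xspace * Bspace) : R[i] :=
  cpow (absd R pi q z.1.1) (s0 * n%:R - 1)
  * \prod_(iota : Idx I)
      cpow (absd R pi q (z.1.2 iota))
        ((inat iota)%:R * (s iota - (n%:R - (inat iota)%:R)) - 1).

End Integration.

End Blocks.

(* Main.v *)
Require Import Defs.
From HB Require Import structures.
From mathcomp Require Import all_boot all_order all_algebra all_fingroup.
From mathcomp Require Import finmap complex.
From mathcomp Require Import all_classical all_reals all_analysis.
From mathcomp Require Import measurable_realfun ring lra.

Set Implicit Arguments.
Unset Strict Implicit.
Unset Printing Implicit Defensive.

Import Order.TTheory GRing.Theory Num.Theory.

Local Open Scope classical_set_scope.
Local Open Scope ring_scope.

(* A lattice of type (I, r_0, r) is a coset Gamma A of GL_n(o), Gamma the group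
   of matrices that are block upper triangular modulo suitable powers of pi.
   Over the residue field, the matrices in R_I represent the cosets of the block
   upper triangular matrices, and each is uniquely of the form E sigma with E in
   L_I and sigma a permutation. Since permuting coordinates is an automorphism of
   the algebra o^n, the subalgebras of the given type are counted by tau(E) times
   the number of distinct lattices <pi^r_0 D B> that are subalgebras, with B in
   L_I(o) reducing to E. Each such lattice comes from a coset of
   Gamma meet L_I(o), whose Haar measure is q^(- sum r_i i (n - i)), and the
   divisibility conditions defining M_I say exactly that <pi^r_0 D B> is closed
   under multiplication when v(x_0) = r_0 and v(x_i) = r_i - 1. So the integrand
   is constant on the pieces of a countable partition of M_I indexed by (r_0, r)
   (up to the locus where some x_i is 0, where it vanishes), and summing over the
   pieces gives the Dirichlet series term by term. *)

(** * Valuations and digits *)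

(** The Haar measures are given only through total mass 1 and left invariance, so volumes are found
    by counting. At a precision [N] all cells with prescribed first [N] digits have equal measure,
    and a set cut out by digit conditions has as measure the proportion of admissible digit strings.
    For L_I(o) the sides do not match: two matrices span the same lattice when they differ by Gamma
    on the left, so the sets to measure are right cosets, while invariance is under left
    translation. Congruence classes modulo [pi ^+ N] are left and right cosets at once, and mediate
    between the two. Each of the |I| + 1 coordinates of x contributes one factor 1 - q^-1, the
    measure of the units of o. The -1 in each exponent of |x_i| cancels the remaining factor q^(-
    v(x_i)) of the sphere volume, and the power of q in front of the sum comes from the shift
    between r_i and v(x_i) = r_i - 1. Convergence needs no bound on the number of subalgebras: for
    real parts above n the integrand is bounded on a space of measure 1, hence integrable, and
    absolute convergence of the Dirichlet series is read off from this. *)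

Section Divisibility.
Variable A : comNzRingType.
Implicit Types a b c : A.

Lemma rdivides_refl a : rdivides a a.
Proof. by exists 1; rewrite mul1r. Qed.

Lemma rdivides_trans a b c : rdivides a b -> rdivides b c -> rdivides a c.
Proof. by move=> [x ->] [y ->]; exists (y * x); rewrite mulrA. Qed.

Lemma rdivides_mull a b c : rdivides a b -> rdivides a (c * b).
Proof. by move=> [x ->]; exists (c * x); rewrite mulrA. Qed.

Lemma rdivides_mulr a b c : rdivides a b -> rdivides a (b * c).
Proof. by rewrite mulrC; apply: rdivides_mull. Qed.

Lemma rdividesD a b c : rdivides a b -> rdivides a c -> rdivides a (b + c).
Proof. by move=> [x ->] [y ->]; exists (x + y); rewrite mulrDl. Qed.

Lemma rdividesN a b : rdivides a b -> rdivides a (- b).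
Proof. by move=> [x ->]; exists (- x); rewrite mulNr. Qed.

Lemma rdivides0 a : rdivides a 0.
Proof. by exists 0; rewrite mul0r. Qed.

Lemma rdivides_sum (J : Type) (r : seq J) (P : pred J) a (F : J -> A) :
  (forall j, P j -> rdivides a (F j)) -> rdivides a (\sum_(j <- r | P j) F j).
Proof.
by move=> aF; apply: big_ind => // [|x y]; [exact: rdivides0|exact: rdividesD].
Qed.

Lemma rdivides_exp a m l : (m <= l)%N -> rdivides (a ^+ m) (a ^+ l).
Proof. by move=> /subnK <-; exists (a ^+ (l - m)); rewrite exprD. Qed.

End Divisibility.

Section DvdUnit.
Variable A : idomainType.
Implicit Types a b c u : A.

Lemma rdivides_mulIr c a b : c != 0 ->
  rdivides (c * a) (c * b) <-> rdivides a b.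
Proof.
move=> c0; split=> [[x]|[x ->]]; last by exists x; rewrite mulrCA.
by rewrite mulrCA => /(mulfI c0) ->; exists x.
Qed.

Lemma rdivides_unitl u a b : u \is a GRing.unit ->
  rdivides (u * a) b <-> rdivides a b.
Proof.
move=> Uu; split=> [[x ->]|[x ->]]; first by exists (x * u); rewrite mulrA.
by exists (x / u); rewrite mulrA divrK.
Qed.

Lemma rdivides_unitr u a b : u \is a GRing.unit ->
  rdivides a (u * b) <-> rdivides a b.
Proof.
move=> Uu; split=> [|]; last exact: rdivides_mull.
by move=> /(rdivides_mull u^-1); rewrite mulKr.
Qed.

End DvdUnit.

Section Valuation.
Variables (o : idomainType) (pi : o) (hd : is_dvr pi).
Implicit Types x y u : o.

Lemma dvr_pi_neq0 : pi != 0. Proof. by case: hd. Qed.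
Lemma dvr_nonunit x : x \isn't a GRing.unit <-> rdivides pi x.
Proof. by case: hd. Qed.

Lemma dvr_expi_neq0 m : pi ^+ m != 0.
Proof. exact: expf_neq0 dvr_pi_neq0. Qed.

Lemma dvr_pi_nonunit : pi \isn't a GRing.unit.
Proof. exact/dvr_nonunit/rdivides_refl. Qed.

Lemma dvr_pi_noninv c : pi * c <> 1.
Proof.
move=> e; have /negP := dvr_pi_nonunit; apply; apply/unitrP.
by exists c; rewrite mulrC.
Qed.

Lemma rdivides_expi_unit m r u : u \is a GRing.unit ->
  rdivides (pi ^+ m) (pi ^+ r * u) <-> (m <= r)%N.
Proof.
move=> Uu; rewrite mulrC rdivides_unitr //; split; last exact: rdivides_exp.
move=> dv; rewrite leqNgt; apply/negP => rm.
move: dv; rewrite -(subnKC (ltnW rm)) exprD -[X in rdivides _ X]mulr1.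
rewrite rdivides_mulIr ?dvr_expi_neq0//.
rewrite -[(m - r)%N]prednK ?subn_gt0// exprS => -[x].
rewrite mulrCA => e; exact: (dvr_pi_noninv (esym e)).
Qed.

(* If every power of pi divided x, the ideal generated by the quotients
   x / pi ^+ N would be an ascending union that is not principal. *)
Lemma expi_ndivides x : x != 0 -> exists N, ~ rdivides (pi ^+ N) x.
Proof.
move=> x0; apply: contrapT => /forallNP H.
have {}H N : exists y, x = y * pi ^+ N by exact: contrapT (H N).
pose y N := projT1 (cid (H N)).
have yE N : x = y N * pi ^+ N by rewrite /y; case: cid.
have yS N : y N = pi * y N.+1.
  apply: (mulIf (dvr_expi_neq0 N)); rewrite -yE [LHS](yE N.+1) exprS.
  by rewrite mulrA [pi * _]mulrC.
have ymono N M : (N <= M)%N -> rdivides (y M) (y N).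
  move=> /subnK <-; elim: (M - N)%N => [|d IH]; first exact: rdivides_refl.
  by apply: rdivides_trans IH; rewrite addSn; exists pi; rewrite -yS.
pose J : set o := [set z | exists N, rdivides (y N) z].
case: hd => /(_ J) [].
  split; first by exists 0%N; exact: rdivides0.
  - move=> a b [N Na] [M Mb]; exists (maxn N M); apply: rdividesD.
      by apply: rdivides_trans Na; apply: ymono; exact: leq_maxl.
    by apply: rdivides_trans Mb; apply: ymono; exact: leq_maxr.
  - by move=> a b [N Nb]; exists N; exact: rdivides_mull.
move=> a Ja _ _.
have [N [c ac]] : J a by rewrite Ja /=; exact: rdivides_refl.
have : J (y N.+1) by exists N.+1; exact: rdivides_refl.
rewrite Ja /= => -[d]; rewrite ac (yS N) => yd.
have yN0 : y N.+1 != 0.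
  by apply: contra_neq x0 => yz; rewrite (yE N.+1) yz mul0r.
have : 1 = pi * (d * c).
  by apply: (mulIf yN0); rewrite mul1r {1}yd [pi * (d * c)]mulrC !mulrA.
by move/esym/dvr_pi_noninv.
Qed.

Lemma vald_unique x r : rdivides (pi ^+ r) x -> ~ rdivides (pi ^+ r.+1) x ->
  vald pi x = r.
Proof.
move=> h1 h2; rewrite /vald; case: xgetP => [m _ [h3 h4]|/(_ r)[]//].
apply/eqP; rewrite eqn_leq; apply/andP; split; rewrite leqNgt; apply/negP => lt.
  by apply: h2; apply: rdivides_trans h3; exact: rdivides_exp.
by apply: h4; apply: rdivides_trans h1; exact: rdivides_exp.
Qed.

Lemma valdP x : x != 0 ->
  exists2 u, u \is a GRing.unit & x = pi ^+ vald pi x * u.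
Proof.
move=> x0; have ex : exists N, `[< ~ rdivides (pi ^+ N) x >].
  by have [N HN] := expi_ndivides x0; exists N; apply/asboolP.
have [[|m] /asboolP Hm minm] := ex_minnP ex.
  by case: Hm; rewrite expr0; exists x; rewrite mulr1.
have hm : rdivides (pi ^+ m) x.
  by apply: contrapT => /asboolP/minm; rewrite ltnn.
rewrite (vald_unique hm Hm); case: hm => u ux; exists u; last by rewrite mulrC.
apply/negPn/negP => /dvr_nonunit[w uw]; apply: Hm; exists w.
by rewrite ux uw exprS mulrA.
Qed.

Lemma vald_eqP x r : x != 0 /\ vald pi x = r <->
  rdivides (pi ^+ r) x /\ ~ rdivides (pi ^+ r.+1) x.
Proof.
split=> [[x0 <-]|[h1 h2]].
  have [u Uu xu] := valdP x0; rewrite {2 4}xu.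
  by split; [exact/rdivides_expi_unit|move/rdivides_expi_unit => /(_ Uu); rewrite ltnn].
split; last exact: vald_unique.
by apply/eqP => x0; apply: h2; rewrite x0; exact: rdivides0.
Qed.

End Valuation.

Section Digits.
Variables (o : topIdomainType) (pi : o) (hd : is_dvr pi).
Variables (k : finFieldType) (red : {rmorphism o -> k}).
Hypothesis hred : is_residue_map pi red.

Lemma red_eq0 x : red x = 0 <-> rdivides pi x.
Proof. by case: hred. Qed.

Lemma red_unit x : (x \is a GRing.unit) = (red x != 0).
Proof.
apply/idP/idP => [Ux|]; first by rewrite -unitfE rmorph_unit.
by apply: contraNT => /(dvr_nonunit hd)/red_eq0 ->.
Qed.

(** Normalised at 0 so that the element 0 has only zero digits; divisibility by [pi ^+ N] then means
    that the first [N] digits vanish. *)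
Definition sec (a : k) : o :=
  if a == 0 then 0 else projT1 (cid (residue_surj hred a)).

Lemma secK : cancel sec red.
Proof.
by move=> a; rewrite /sec; case: eqP => [->|_]; [rewrite rmorph0|case: cid].
Qed.

Lemma sec0 : sec 0 = 0. Proof. by rewrite /sec eqxx. Qed.

Lemma shift_subproof x : exists y, x = sec (red x) + pi * y.
Proof.
have /red_eq0[y xy] : red (x - sec (red x)) = 0.
  by rewrite rmorphB/= secK subrr.
by exists y; rewrite mulrC -xy addrC subrK.
Qed.

Definition shift x := projT1 (cid (shift_subproof x)).

Lemma shiftE x : x = sec (red x) + pi * shift x.
Proof. by rewrite /shift; case: cid. Qed.

(** Coefficient of [pi ^+ i] in the expansion of [x] with representatives [sec]. Such digits need
    not be additive; what matters is that the first [N] of them determine the class modulo [pi ^+ N]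
    and can be prescribed freely. *)
Definition digit i x : k := red (iter i shift x).

Lemma red_pi : red pi = 0.
Proof. exact/red_eq0/rdivides_refl. Qed.

Lemma red_sec a y : red (sec a + pi * y) = a.
Proof. by rewrite rmorphD rmorphM/= secK red_pi mul0r addr0. Qed.

Lemma shift_sec a y : shift (sec a + pi * y) = y.
Proof.
have := shiftE (sec a + pi * y); rewrite red_sec => /addrI.
by move/(mulfI (dvr_pi_neq0 hd)).
Qed.

Lemma digitS i x : digit i.+1 x = digit i (shift x).
Proof. by rewrite /digit iterSr. Qed.

Lemma digit_cong N x y :
  rdivides (pi ^+ N) (x - y) <-> (forall i, (i < N)%N -> digit i x = digit i y).
Proof.
elim: N x y => [|N IH] x y.
  by split=> // _; exists (x - y); rewrite mulr1.
have red_xy : red x = red y ->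
    (rdivides (pi ^+ N.+1) (x - y) <-> rdivides (pi ^+ N) (shift x - shift y)).
  move=> rxy; rewrite {1}(shiftE x) {1}(shiftE y) rxy opprD addrACA subrr add0r.
  by rewrite -mulrBr exprS rdivides_mulIr// dvr_pi_neq0.
split=> [dv [_|i]|dig].
- apply/eqP; rewrite -subr_eq0 /digit/= -rmorphB; apply/eqP/red_eq0; apply: rdivides_trans dv.
  by rewrite exprS; exists (pi ^+ N); rewrite mulrC.
- rewrite ltnS => iN; rewrite !digitS; apply: (IH _ _).1 iN; apply/red_xy => //.
  apply/eqP; rewrite -subr_eq0 -rmorphB/=.
  apply/eqP/red_eq0; apply: rdivides_trans dv.
  by rewrite exprS; exists (pi ^+ N); rewrite mulrC.
- apply/red_xy; first exact: (dig 0%N).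
  by apply/IH => i iN; rewrite -!digitS; exact: dig.
Qed.

Lemma digit_surj N (f : nat -> k) :
  exists x, forall i, (i < N)%N -> digit i x = f i.
Proof.
elim: N f => [|N IH] f; first by exists 0.
have [y yf] := IH (fun i => f i.+1).
exists (sec (f 0%N) + pi * y) => -[_|i iN].
  exact: red_sec.
by rewrite digitS shift_sec yf.
Qed.

Lemma digit0 i : digit i 0 = 0.
Proof.
elim: i => [|i IH]; first by rewrite /digit /= rmorph0.
rewrite digitS; suff -> : shift 0 = 0 by [].
by have := shift_sec 0 0; rewrite sec0 mulr0 addr0.
Qed.

Lemma rdivides_digit N x :
  rdivides (pi ^+ N) x <-> (forall i, (i < N)%N -> digit i x = 0).
Proof.
have := digit_cong N x 0; rewrite subr0 => ->.
by split=> H i /H; rewrite digit0.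
Qed.

Definition digits N x : {ffun 'I_N -> k} := [ffun i : 'I_N => digit i x].

Lemma digits_eqP N x y : digits N x = digits N y <-> rdivides (pi ^+ N) (x - y).
Proof.
rewrite digit_cong; split=> [/ffunP e i iN|e].
  by have := e (Ordinal iN); rewrite !ffunE.
by apply/ffunP => i; rewrite !ffunE e.
Qed.

Lemma digits_surj N d : exists x, digits N x = d.
Proof.
have [x xd] := digit_surj N
  (fun i => if insub i is Some j then d j else 0).
by exists x; apply/ffunP => i; rewrite ffunE xd// valK.
Qed.

Definition ball_digits N r : pred {ffun 'I_N -> k} :=
  fun d => [forall i : 'I_N, (i < r)%N ==> (d i == 0)].

Definition sphere_digits N r : pred {ffun 'I_N -> k} :=
  fun d => [forall i : 'I_N, if (i < r)%N then d i == 0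
                             else (i == r :> nat) ==> (d i != 0)].

Lemma ball_digitsP N r x : (r <= N)%N ->
  ball_digits r (digits N x) <-> rdivides (pi ^+ r) x.
Proof.
move=> rN; rewrite rdivides_digit; split.
  move=> /forallP H i ir.
  by have /implyP/(_ ir)/eqP := H (Ordinal (leq_trans ir rN)); rewrite ffunE.
by move=> H; apply/forallP => i; apply/implyP => ir; rewrite ffunE H.
Qed.

Lemma sphere_digitsP N r x : (r < N)%N ->
  sphere_digits r (digits N x) <-> x != 0 /\ vald pi x = r.
Proof.
move=> rN; rewrite (vald_eqP hd) !rdivides_digit; split.
  move=> /forallP H.
  split=> [i ir|].
    by have := H (Ordinal (ltn_trans ir rN)); rewrite /= ir ffunE => /eqP.
  move=> H0; have := H (Ordinal rN); rewrite /= ltnn eqxx ffunE /= H0//.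
  by rewrite eqxx.
move=> [H1 H2]; apply/forallP => i; rewrite ffunE; case: ltnP => ir.
  by rewrite H1.
apply/implyP => /eqP er; apply: contra_not_neq H2 => d0 j.
by rewrite ltnS leq_eqVlt => /predU1P[->|/H1//]; rewrite -er.
Qed.

Lemma card_ffun_family (J : finType) (T : finType) (F : J -> pred T) :
  #|[pred d : {ffun J -> T} | [forall j, F j (d j)]]| = (\prod_j #|F j|)%N.
Proof.
have := card_family (fun j => F j); rewrite foldrE big_map => h.
rewrite -[RHS]big_enum; apply: etrans h.
by apply: eq_card => d; rewrite !inE; apply: eq_forallb => j.
Qed.

Variable R : realType.
Local Notation q := (#|k|%:R : R).

Lemma q_gt1 : 1 < q.
Proof. by rewrite ltr1n; exact: card_finNzRing_gt1. Qed.

Lemma ball_digits_density N r : (r <= N)%N ->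
  #|@ball_digits N r|%:R / q ^+ N = q^-1 ^+ r.
Proof.
move=> rN; rewrite (@card_ffun_family _ _ (fun i : 'I_N => [pred a : k | (i < r)%N ==> (a == 0)])).
have q0 : q != 0 by rewrite gt_eqF// (lt_trans _ q_gt1).
rewrite natr_prod -[in X in _ / X](card_ord N) -prodr_const -prodf_div.
rewrite (eq_bigr (fun i : 'I_N => if (i < r)%N then q^-1 else 1)); last first.
  move=> i _; case: ifP => ir.
    by rewrite (eq_card (_ : _ =i pred1 (0 : k))) ?card1 ?mul1r.
  by rewrite (eq_card (_ : _ =i predT)) ?divff.
by rewrite -big_mkcond/= -(big_ord_widen N (fun=> q^-1) rN) prodr_const card_ord.
Qed.

(** The [r] lowest digits are forced, at the cost of a factor 1/q each; the next one avoids a single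
    value out of q; the others are free. The precision must exceed [r] for the nonzero digit to be
    visible. *)
Lemma sphere_digits_density N r : (r < N)%N ->
  #|@sphere_digits N r|%:R / q ^+ N = q^-1 ^+ r * (1 - q^-1).
Proof.
move=> rN; rewrite (@card_ffun_family _ _ (fun i : 'I_N => [pred a : k |
   if (i < r)%N then a == 0 else (i == r :> nat) ==> (a != 0)])).
have q0 : q != 0 by rewrite gt_eqF// (lt_trans _ q_gt1).
rewrite natr_prod -[in X in _ / X](card_ord N) -prodr_const -prodf_div.
rewrite (bigD1 (Ordinal rN))//= mulrC; congr (_ * _); last first.
  rewrite (eq_card (_ : _ =i predC1 (0 : k))); last first.
    by move=> a; rewrite /in_mem/= ltnn eqxx.
  rewrite cardC1 -subn1 natrB ?mulrBl ?divff ?mul1r//.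
  by rewrite -(ltr_nat R) ?(lt_trans _ q_gt1).
rewrite (eq_bigr (fun i : 'I_N => if (i < r)%N then q^-1 else 1)); last first.
  move=> i ineq; case: ifP => ir.
    by rewrite (eq_card (_ : _ =i pred1 (0 : k))) ?card1 ?mul1r.
  rewrite (eq_card (_ : _ =i predT)) ?divff// => a.
  by rewrite /in_mem/= (negPf (_ : i != r :> nat)).
rewrite -big_mkcondr/= (eq_bigl (fun i : 'I_N => (i < r)%N)); last first.
  move=> i; case: ltnP; rewrite ?andbF// andbT => ir.
  by apply/eqP => e; move: ir; rewrite e ltnn.
by rewrite -(big_ord_widen N (fun=> q^-1) (ltnW rN)) prodr_const card_ord.
Qed.

End Digits.

(** * Block triangular matrices and row reduction *)

Section Blocks.
Variables (n : nat) (I : {set 'I_n}).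
Implicit Types i j l : 'I_n.

Lemma blk_homo i j : (i <= j)%N -> (blk I i <= blk I j)%N.
Proof.
move=> ij; apply/subset_leq_card/fintype.subsetP => x; rewrite !inE => /andP[-> xi].
exact: leq_trans ij.
Qed.

Lemma blk_lt i j : (blk I i < blk I j)%N -> (i < j)%N.
Proof. by move=> h; rewrite ltnNge; apply: contraTN h => /blk_homo; rewrite leqNgt. Qed.

Lemma ord_ltF i j : (i < j)%N -> (i == j) = false.
Proof. by move=> ij; rewrite -val_eqE ltn_eqF. Qed.

Lemma blk_ltF i j : (blk I j < blk I i)%N -> (i == j) = false.
Proof. by move/blk_lt/ord_ltF; rewrite eq_sym. Qed.

Lemma blk_leP i j (iota : Idx I) : (blk I i <= blk I j)%N ->
  (inat iota <= i)%N -> (inat iota <= j)%N.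
Proof.
move=> bij hi; rewrite leqNgt; apply/negP => hj; move: bij; apply/negP.
rewrite -ltnNge; apply/proper_card/fintype.properP; split.
  apply/fintype.subsetP => x; rewrite !inE => /andP[-> xi].
  exact: leq_trans xi (leq_trans (ltnW hj) hi).
by exists (val iota); rewrite !inE (valP iota)//= -ltnNge.
Qed.

Lemma blk_lt_ex i j : (blk I j < blk I i)%N ->
  exists iota : Idx I, (j < inat iota <= i)%N.
Proof.
move=> h; apply: contrapT => /forallNP H; move: h; apply/negP; rewrite -leqNgt.
apply/subset_leq_card/fintype.subsetP => x; rewrite !inE => /andP[xI xi]; rewrite xI /=.
by have := H (exist _ x xI); rewrite /inat/= xi andbT => /negP; rewrite -leqNgt.
Qed.

Variable r : {ffun Idx I -> nat}.

Definition dwt i : nat := \sum_(iota : Idx I | (i < inat iota)%N) r iota.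
(** For [j <= i] this is [dwt j - dwt i], where [dwt] gives the exponents on the diagonal of [Dmx]:
    the power of pi that must divide the entry (i, j) of an element of Gamma. *)
Definition ewt i j : nat := \sum_(iota : Idx I | (j < inat iota <= i)%N) r iota.

Lemma dwt_ewt i j : (j <= i)%N -> dwt j = (dwt i + ewt i j)%N.
Proof.
move=> ji; rewrite /dwt (bigID (fun iota : Idx I => (i < inat iota)%N))/=.
congr (_ + _)%N; apply: eq_bigl => iota; rewrite -?leqNgt//.
by rewrite andbC; case: ltnP => //= /(leq_ltn_trans ji) ->.
Qed.

Lemma dwt_le i j : (blk I i <= blk I j)%N -> (dwt j <= dwt i)%N.
Proof.
move=> bij; rewrite /dwt big_mkcond [leqRHS]big_mkcond; apply: leq_sum => iota _.
case: ltnP => // h; case: ltnP => // h2.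
by have := blk_leP bij h2; rewrite leqNgt h.
Qed.

Lemma ewt_le i j : (ewt i j <= \sum_iota r iota)%N.
Proof. by rewrite /ewt [leqRHS](bigID (fun iota : Idx I => (j < inat iota <= i)%N)) leq_addr. Qed.

Lemma dwt_le_sum i : (dwt i <= \sum_iota r iota)%N.
Proof. by rewrite /dwt [leqRHS](bigID (fun iota : Idx I => (i < inat iota)%N)) leq_addr. Qed.

Lemma ewt_gt0 i j : (forall iota, (0 < r iota)%N) -> (blk I j < blk I i)%N ->
  (0 < ewt i j)%N.
Proof.
move=> r0 /blk_lt_ex[iota h]; rewrite /ewt (bigD1 iota)//=.
exact: leq_trans (r0 iota) (leq_addr _ _).
Qed.

End Blocks.

Section LowerBlocks.
Variables (n : nat) (I : {set 'I_n}) (A : comUnitRingType).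
Implicit Types B C : 'M[A]_n.

Lemma in_LP B : reflect (B \in unitmx /\
  forall i j, (blk I i <= blk I j)%N -> B i j = (i == j)%:R) (in_L I B).
Proof.
apply: (iffP andP) => -[-> h]; split=> //.
  by move=> i j ij; move/forallP/(_ i)/forallP/(_ j): h; rewrite ij => /eqP.
by apply/forallP => i; apply/forallP => j; apply/implyP => /h/eqP.
Qed.

Lemma in_L_unit B : in_L I B -> B \in unitmx. Proof. by move/in_LP => []. Qed.

Lemma in_L_entry B (i j : 'I_n) : in_L I B -> (blk I i <= blk I j)%N -> B i j = (i == j)%:R.
Proof. by move/in_LP => [_]; apply. Qed.

Lemma in_L_upper B (i j : 'I_n) : in_L I B -> (i < j)%N -> B i j = 0.
Proof.
move=> LB ij; by rewrite (in_L_entry LB) ?blk_homo ?ord_ltF// ltnW.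
Qed.

Lemma in_L_of_entries B :
  (forall i j, (blk I i <= blk I j)%N -> B i j = (i == j)%:R) -> in_L I B.
Proof.
move=> h; apply/in_LP; split=> //.
rewrite unitmxE det_trig.
  by rewrite big1 ?unitr1// => i _; rewrite h// eqxx.
apply/is_trig_mxP => i j ij; by rewrite h ?blk_homo ?ord_ltF// ltnW.
Qed.

Lemma in_L_mul B C : in_L I B -> in_L I C -> in_L I (B *m C).
Proof.
move=> LB LC; apply: in_L_of_entries => i j ij; rewrite mxE (bigD1 i)//=.
rewrite (in_L_entry LB)// eqxx mul1r (in_L_entry LC)// big1 ?addr0// => l li.
have [il|li'] := leqP (blk I i) (blk I l).
  by rewrite (in_L_entry LB)// eq_sym (negPf li) mul0r.
rewrite (in_L_entry LC); last exact: leq_trans (ltnW li') ij.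
by rewrite (@ord_ltF _ l) ?mulr0// (@blk_lt _ I)// (leq_trans li').
Qed.

(** Strong induction on the row: reading row [i] of [B *m invmx B = 1], all that accompanies row [i]
    of the inverse are its rows in strictly earlier blocks. *)
Lemma in_L_inv B : in_L I B -> in_L I (invmx B).
Proof.
move=> LB; apply: in_L_of_entries => i; have [m] := ubnP (val i).
elim: m i => // m IH i im j ij.
have := congr1 (fun M : 'M[A]_n => M i j) (mulmxV (in_L_unit LB)).
rewrite !mxE (bigD1 i)//= (in_L_entry LB)// eqxx mul1r big1 ?addr0// => l li.
have [il|li'] := leqP (blk I i) (blk I l).
  by rewrite (in_L_entry LB)// eq_sym (negPf li) mul0r.
rewrite IH; last exact: leq_trans (ltnW li') ij.
- by rewrite (@ord_ltF _ l) ?mulr0// (@blk_lt _ I)// (leq_trans li').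
- exact: leq_trans (blk_lt li') im.
Qed.

End LowerBlocks.

Lemma in_L_map n (I : {set 'I_n}) (A A' : comUnitRingType)
  (f : {rmorphism A -> A'}) (B : 'M[A]_n) : in_L I B -> in_L I (map_mx f B).
Proof.
by move=> LB; apply: in_L_of_entries => i j ij; rewrite mxE (in_L_entry LB)// rmorph_nat.
Qed.

(** * Row operations by block upper triangular matrices *)

Section Parabolic.
Variables (n : nat) (I : {set 'I_n}) (A : comUnitRingType).
Implicit Types g h : 'M[A]_n.

Definition bup g := forall i j, (blk I j < blk I i)%N -> g i j = 0.

Lemma bup1 : bup 1%:M.
Proof.
by move=> i j h; rewrite mxE (blk_ltF h).
Qed.

Lemma bup_mul g h : bup g -> bup h -> bup (g *m h).
Proof.
move=> Pg Ph i j ji; rewrite mxE big1// => l _.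
have [il|li] := leqP (blk I i) (blk I l); last by rewrite Pg ?mul0r.
by rewrite Ph ?mulr0//; exact: leq_trans ji il.
Qed.

(** The row operations that preserve every lattice of type [I]: a row may be modified by rows of its
    own block or of later blocks, never by rows of earlier ones. *)
Definition peq h h' := exists g, [/\ g \in unitmx, bup g & h = g *m h'].

Lemma peq_refl h : peq h h.
Proof. by exists 1%:M; rewrite unitmx1 mul1mx; split=> //; exact: bup1. Qed.

Lemma peq_trans h1 h2 h3 : peq h1 h2 -> peq h2 h3 -> peq h1 h3.
Proof.
move=> [g [Ug Pg ->]] [g' [Ug' Pg' ->]]; exists (g *m g').
by rewrite unitmx_mul Ug Ug' mulmxA; split=> //; exact: bup_mul.
Qed.

Lemma peq_unit h1 h2 : peq h1 h2 -> h2 \in unitmx -> h1 \in unitmx.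
Proof. by move=> [g [Ug _ ->]] U; rewrite unitmx_mul Ug. Qed.

Lemma peq_swap h (i0 i1 : 'I_n) : blk I i0 = blk I i1 -> peq (xrow i0 i1 h) h.
Proof.
move=> e; exists (tperm_mx i0 i1); rewrite unitmx_perm xrowE; split=> //.
move=> i j ji; rewrite !mxE (@blk_ltF _ I)//.
by case: tpermP => [ei|ei|_ _] //; rewrite ei in ji; [rewrite -e|rewrite e].
Qed.

(** The multiple of row [i0] that is added to row [i]. On row [i0] itself, adding the inverse pivot
    minus 1 amounts to scaling by the inverse pivot; later blocks are left alone, as [bup]
    demands. *)
Definition pivot_coef h (i0 m : 'I_n) (i : 'I_n) : A :=
  if i == i0 then (h i0 m)^-1 - 1
  else if (blk I i <= blk I i0)%N then - (h i m / h i0 m) else 0.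

Definition pivot h (i0 m : 'I_n) : 'M[A]_n :=
  \matrix_(i, j) (h i j + pivot_coef h i0 m i * h i0 j).

(* The matrix of the row operation is 1 + w e with e a coordinate row, and its
   inverse is 1 - (h i0 m) w e. *)
Lemma peq_pivot h (i0 m : 'I_n) : h i0 m \is a GRing.unit -> peq (pivot h i0 m) h.
Proof.
move=> Uu; set u := h i0 m.
pose w : 'cV[A]_n := \col_i pivot_coef h i0 m i.
pose e : 'rV[A]_n := delta_mx 0 i0.
have ew : e *m w = (u^-1 - 1)%:M.
  rewrite -rowE [LHS]mx11_scalar; congr (_%:M).
  by rewrite !mxE /pivot_coef eqxx.
exists (1%:M + w *m e); split.
- apply: (proj1 (mulmx1_unit (B := 1%:M - u *: (w *m e)) _)).
  rewrite mulmxDl mul1mx mulmxBr mulmx1 -scalemxAr !mulmxA.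
  rewrite -(mulmxA w e w) ew mul_mx_scalar -scalemxAl scalerA.
  rewrite mulrBr mulr1 divrr// scalerBl scale1r.
  by rewrite subKr subrK.
- move=> i j ji; rewrite mxE bup1// add0r !mxE big_ord1 !mxE /pivot_coef eqxx /=.
  case: (j =P i0) => [ej|_]; last by rewrite mulr0.
  by rewrite ej in ji; rewrite leqNgt ji /= (blk_ltF ji) mul0r.
- rewrite mulmxDl mul1mx -mulmxA -rowE; apply/matrixP => i j.
  by rewrite !mxE big_ord1 !mxE.
Qed.

Lemma pivot_pivot h (i0 m j : 'I_n) : pivot h i0 m i0 j = (h i0 m)^-1 * h i0 j.
Proof. by rewrite mxE /pivot_coef eqxx mulrBl mul1r addrC subrK. Qed.

Lemma pivot_col h (i0 m i : 'I_n) : h i0 m \is a GRing.unit ->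
  (blk I i <= blk I i0)%N -> pivot h i0 m i m = (i == i0)%:R.
Proof.
move=> Uu ii; case: eqP => [->|/eqP ne]; first by rewrite pivot_pivot mulVr.
by rewrite mxE /pivot_coef (negPf ne) ii mulNr divrK// subrr.
Qed.

Lemma pivot_below h (i0 m i j : 'I_n) : (blk I i0 < blk I i)%N ->
  pivot h i0 m i j = h i j.
Proof.
by move=> ii; rewrite mxE /pivot_coef leqNgt ii /= (blk_ltF ii) mul0r addr0.
Qed.

Lemma pivot_id h (i0 m i j : 'I_n) : h i0 j = 0 -> pivot h i0 m i j = h i j.
Proof. by move=> h0; rewrite mxE h0 mulr0 addr0. Qed.

End Parabolic.

(** * Uniqueness of the representatives in R_I over the residue field *)

Section Echelon.
Variables (n : nat) (I : {set 'I_n}) (k : finFieldType).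
Implicit Types (A g : 'M[k]_n) (c : 'I_n -> 'I_n).

(** Membership in R_I with the positions [c] of the leading 1's made explicit. [ech_zero] also
    covers the lower rows of the same block, where the vanishing follows from the increasing
    positions. *)
Record echelon A c : Prop := Echelon {
  ech_one : forall i, A i (c i) = 1;
  ech_left : forall i (j : 'I_n), (j < c i)%N -> A i j = 0;
  ech_zero : forall i i', (blk I i <= blk I i')%N -> i != i' -> A i (c i') = 0;
  ech_mono : forall i i', blk I i = blk I i' -> (i < i')%N -> (c i < c i')%N }.

Lemma ech_inj A c : echelon A c -> injective c.
Proof.
move=> ech; suff H i i' : (blk I i <= blk I i')%N -> c i = c i' -> i = i'.
  by move=> i i' e; have [le|/ltnW le] := leqP (blk I i) (blk I i');
    [apply: H|apply/esym/H].
move=> le e; apply/eqP; apply: contraT => ne.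
have := ech_zero ech le ne; rewrite -e (ech_one ech) => /eqP.
by rewrite oner_eq0.
Qed.

Lemma ech_leading A c i x : echelon A c -> leading A i x = (x == c i).
Proof.
move=> ech; apply/idP/eqP => [/andP[xn0 /forallP h]|->].
  apply/val_inj/eqP; rewrite eqn_leq; apply/andP; split; rewrite leqNgt.
    apply/negP => lt; have := h (c i); rewrite lt (ech_one ech) /=.
    by rewrite oner_eq0.
  by apply/negP => lt; move: xn0; rewrite (ech_left ech)// eqxx.
apply/andP; rewrite (ech_one ech) oner_neq0; split=> //.
by apply/forallP => j; apply/implyP => /(ech_left ech) ->.
Qed.

Lemma in_RIP A : in_RI I A <-> A \in unitmx /\ exists c, echelon A c.
Proof.
split=> [/and4P[UA /forallP h1 /forallP h2 /forallP h3]|[UA [c ech]]]; last first.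
  apply/and4P; split=> //; apply/forallP => i; apply/forallP => x.
  - by rewrite (ech_leading _ _ ech); apply/implyP => /eqP ->; rewrite (ech_one ech).
  - rewrite (ech_leading _ _ ech); apply/implyP => /eqP ->; apply/forallP => i'.
    apply/implyP => lt; apply/eqP/(ech_zero ech); last by rewrite ord_ltF.
    exact/blk_homo/ltnW.
  - apply/forallP => y; apply/forallP => z.
    rewrite !(ech_leading _ _ ech); apply/implyP.
    by move=> /and4P[/eqP b lt /eqP -> /eqP ->]; exact: (ech_mono ech).
have ex i : exists x, leading A i x.
  have [j Aij] : exists j, A i j != 0.
    apply/existsP; apply: contraT => /existsPn H.
    have := congr1 (fun M : 'M[k]_n => M i i) (mulmxV UA).
    rewrite !mxE eqxx big1 => [/esym/eqP|j _]; first by rewrite oner_eq0.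
    by have := H j; rewrite negbK => /eqP ->; rewrite mul0r.
  case: (arg_minnP (fun j : 'I_n => val j) (i0 := j) (P := fun j => A i j != 0) Aij).
  move=> x xn0 xmin; exists x; apply/andP; split=> //.
  apply/forallP => y; apply/implyP; apply: contraTT => /xmin.
  by rewrite -leqNgt.
pose c i := xchoose (ex i).
have cP i : leading A i (c i) := xchooseP (ex i).
have left i (j : 'I_n) : (j < c i)%N -> A i j = 0.
  by move=> lt; have /andP[_ /forallP/(_ j)] := cP i; rewrite lt => /eqP.
have mono i i' : blk I i = blk I i' -> (i < i')%N -> (c i < c i')%N.
  move=> b lt; have /forallP/(_ i')/forallP/(_ (c i))/forallP/(_ (c i')) := h3 i.
  by rewrite b eqxx lt !cP.
split=> //; exists c; split=> //.
  by move=> i; have /forallP/(_ (c i)) := h1 i; rewrite cP => /eqP.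
move=> i i' le ne; have [lt|lt|e] := ltngtP i i'.
- have /forallP/(_ (c i')) := h2 i'; rewrite cP => /forallP/(_ i).
  by rewrite lt => /eqP.
- apply: left; apply: mono => //; apply/eqP; rewrite eqn_leq le andbT.
  exact/blk_homo/ltnW.
- by rewrite (val_inj e) eqxx in ne.
Qed.

(** Among the rows that occur in the combination, take the one whose leading 1 is leftmost: the
    others start strictly to its right, so its coefficient survives as the leading entry. *)
Lemma ech_combination A c (h : 'rV[k]_n) : echelon A c -> h != 0 ->
  exists l, [/\ h 0 l != 0, (h *m A) 0 (c l) = h 0 l &
     forall j : 'I_n, (j < c l)%N -> (h *m A) 0 j = 0].
Proof.
move=> ech h0; have [l0 hl0] : exists l, h 0 l != 0.
  apply/existsP; apply: contraNT h0 => /existsPn H.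
  by apply/eqP/rowP => j; have := H j; rewrite negbK mxE => /eqP.
case: (arg_minnP (fun j : 'I_n => val (c j)) (i0 := l0)
  (P := fun j => h 0 j != 0) hl0) => l hl lmin.
exists l; split=> //.
  rewrite mxE (bigD1 l)//= (ech_one ech) mulr1 big1 ?addr0// => j jl.
  have [->|/eqP hj] := eqVneq (h 0 j) 0; first by rewrite mul0r.
  rewrite (ech_left ech) ?mulr0// ltn_neqAle lmin ?andbT//; last exact/eqP.
  by apply: contra_neq jl => /val_inj/(ech_inj ech).
move=> j jl; rewrite mxE big1// => i _.
have [->|hi] := eqVneq (h 0 i) 0; first by rewrite mul0r.
by rewrite (ech_left ech) ?mulr0// (leq_trans jl)// lmin.
Qed.

(** The sum of [blk] over all indices is invariant under [rho], so none of the inequalities can be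
    strict. *)
Lemma blk_perm_preserve (rho : 'I_n -> 'I_n) : injective rho ->
  (forall i, (blk I i <= blk I (rho i))%N) -> forall i, blk I (rho i) = blk I i.
Proof.
move=> inj le i; apply/eqP; rewrite eqn_leq le andbT -subn_eq0.
have : (\sum_i (blk I (rho i) - blk I i) = 0)%N.
  rewrite sumnB//; apply/eqP; rewrite subn_eq0.
  by rewrite [leqRHS](reindex_inj inj).
by move/eqP; rewrite sum_nat_eq0 => /forallP/(_ i).
Qed.

Lemma blk_perm_mono (rho : 'I_n -> 'I_n) : injective rho ->
  (forall i, blk I (rho i) = blk I i) ->
  (forall i i', blk I i = blk I i' -> (i < i')%N -> (rho i < rho i')%N) ->
  rho =1 id.
Proof.
move=> inj pres mono i; have [m] := ubnP (val i).
elim: m i => // m IH i im; have [lt|lt|/val_inj//] := ltngtP (rho i) i.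
  have /inj e := IH (rho i) (leq_trans lt im).
  by rewrite e ltnn in lt.
have [j rj] : exists j, rho j = i.
  by have [f _ fK] := injF_bij inj; exists (f i).
have [ji|ij|/val_inj ji] := ltngtP j i.
- have e := IH j (leq_trans ji im); rewrite rj /= in e.
  by rewrite -e ltnn in ji.
- have := mono i j; rewrite -[in blk I i]rj pres => /(_ erefl ij).
  by rewrite rj => /(ltn_trans lt); rewrite ltnn.
- by rewrite ji in rj; rewrite rj ltnn in lt.
Qed.

(** Row [i] of [A'] is a combination of rows of [A] in its own or later blocks, so its leading
    position is that of some row [rho i] of [A]. The map [rho] is injective, never lowers the block
    and respects the order inside blocks, hence is the identity: both matrices have the same leading
    positions. *)
Lemma echelon_unique A A' c c' g : echelon A c -> echelon A' c' ->
  bup I g -> A' = g *m A -> A' = A.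
Proof.
move=> ech ech' Pg A'E.
have rowE i : row i A' = row i g *m A by rewrite A'E row_mul.
have ex i : exists l, (blk I i <= blk I l)%N /\ c' i = c l.
  have gi : row i g != 0.
    apply: contraTneq (oner_neq0 k) => gi0; rewrite negbK.
    have := congr1 (fun M : 'rV[k]_n => M 0 (c' i)) (rowE i).
    by rewrite gi0 mul0mx !mxE (ech_one ech') => ->.
  have [l [gl e0 left]] := ech_combination ech gi; exists l; split.
    rewrite leqNgt; apply: contra_neqN gl => lt; rewrite mxE.
    exact: Pg.
  rewrite -rowE in e0 left.
  apply/val_inj/eqP; rewrite eqn_leq; apply/andP; split; rewrite leqNgt;
    apply/negP => lt.
    by move: gl; rewrite -e0 mxE (ech_left ech')// eqxx.
  have := left _ lt; rewrite mxE (ech_one ech') => /eqP.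
  by rewrite oner_eq0.
pose rho i := projT1 (cid (ex i)).
have rho_blk i : (blk I i <= blk I (rho i))%N by rewrite /rho; case: cid => ? [].
have rhoc i : c' i = c (rho i) by rewrite /rho; case: cid => ? [].
have rho_inj : injective rho.
  by move=> i j e; apply: (ech_inj ech'); rewrite !rhoc e.
have rho_pres := blk_perm_preserve rho_inj rho_blk.
have rho_id : rho =1 id.
  apply: blk_perm_mono => // i i' b lt; have := ech_mono ech' b lt; rewrite !rhoc.
  apply: contraTT; rewrite -!leqNgt leq_eqVlt => /predU1P[/val_inj ->//|lt'].
  by apply/ltnW/(ech_mono ech) => //; rewrite !rho_pres.
have cc i : c' i = c i by rewrite rhoc rho_id.
(* A nonzero row of [g - 1] would give [A' - A] a nonzero entry at some leading position [c l] with
   [l] in the same or a later block, but there [A] and [A'] have the same entry, 0 or 1. *)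
suff g1 : g = 1%:M by rewrite A'E g1 mul1mx.
apply/row_matrixP => i; apply/eqP; rewrite -subr_eq0; apply: contraT => hn0.
have [l [hl e0 _]] := ech_combination ech hn0.
have il : (blk I i <= blk I l)%N.
  rewrite leqNgt; apply: contra_neqN hl => lt.
  by rewrite !mxE Pg// (blk_ltF lt) subr0.
move: hl; rewrite -e0 mulmxBl -rowE -row_mul mul1mx !mxE -cc.
have [->|ne] := eqVneq i l.
  by rewrite (ech_one ech') cc (ech_one ech) subrr eqxx.
by rewrite (ech_zero ech')// cc (ech_zero ech)// subrr eqxx.
Qed.

(** The 1 at (j, j) in [E'] is the entry of [E] at (j, t j), with [t] the quotient of the
    permutations. As [E] is lower triangular, [t j <= j] for all [j], and only the identity
    satisfies this. *)
Lemma col_perm_in_L_inj (E E' : 'M[k]_n) (s s' : 'S_n) :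
  in_L I E -> in_L I E' -> col_perm s E = col_perm s' E' -> s = s' /\ E = E'.
Proof.
move=> LE LE' e.
have E'E : E' = col_perm (s'^-1 * s)%g E.
  by rewrite col_permM e -col_permM mulVg col_perm1.
suff t1 : (s'^-1 * s = 1)%g.
  split; last by rewrite E'E t1 col_perm1.
  by apply/esym; rewrite -[RHS](mulKVg s') t1 mulg1.
apply/permP => i; rewrite perm1.
have le j : ((s'^-1 * s)%g j <= j)%N.
  rewrite leqNgt; apply/negP => lt.
  have := in_L_entry LE' (leqnn (blk I j)).
  by rewrite eqxx E'E mxE (in_L_upper LE)// => /eqP; rewrite eq_sym oner_eq0.
have : (\sum_j (val j - val ((s'^-1 * s)%g j)) = 0)%N.
  rewrite sumnB => [|j _]; last exact: le.
  apply/eqP; rewrite subn_eq0.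
  by rewrite [leqLHS](reindex_inj (@perm_inj _ (s'^-1 * s)%g)).
move/eqP; rewrite sum_nat_eq0 => /forallP/(_ i); rewrite /= subn_eq0 => le2.
by apply/val_inj/eqP; rewrite eqn_leq le.
Qed.

(** Moving the leading 1 of each row to the diagonal turns [ech_one] and [ech_zero] into the shape
    of L_I; this is the factorisation of an element of R_I as E sigma. *)
Lemma echelon_col_perm A c (s : 'S_n) : A \in unitmx -> echelon A c -> s =1 c ->
  in_L I (col_perm s A).
Proof.
move=> UA ech sc; apply: in_L_of_entries => i j ij; rewrite mxE sc.
by case: eqVneq => [->|ne]; [exact: (ech_one ech)|exact: (ech_zero ech)].
Qed.

End Echelon.

(** * Elimination over [o], guided by the residues *)

Section Elimination.
Variables (o : topIdomainType) (pi : o) (hd : is_dvr pi).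
Variables (k : finFieldType) (red : {rmorphism o -> k}).
Hypothesis hred : is_residue_map pi red.
Variables (n : nat) (I : {set 'I_n}).
Implicit Types (A B : 'M[o]_n) (S : {set 'I_n}).

(* The first m columns have been processed, and S is the set of rows that
   received a pivot. *)
Record partial_echelon (m : nat) A (S : {set 'I_n}) (c : 'I_n -> 'I_n) : Prop :=
 PartialEchelon {
  pe_bound : forall i, i \in S -> (c i < m)%N;
  pe_one : forall i, i \in S -> red (A i (c i)) = 1;
  pe_left : forall i (j : 'I_n), i \in S -> (j < c i)%N -> red (A i j) = 0;
  pe_out : forall i (j : 'I_n), i \notin S -> (j < m)%N -> red (A i j) = 0;
  pe_zero : forall i i', i' \in S -> (blk I i <= blk I i')%N -> i != i' ->
    red (A i (c i')) = 0;
  pe_mono : forall i i', i \in S -> i' \in S -> blk I i = blk I i' ->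
    (i < i')%N -> (c i < c i')%N;
  pe_initial : forall i i', i' \in S -> blk I i = blk I i' -> (i < i')%N ->
    i \in S }.

Lemma partial_echelon_swap m A S c i0 i1 : i0 \notin S -> i1 \notin S ->
  blk I i0 = blk I i1 -> partial_echelon m A S c ->
  partial_echelon m (xrow i0 i1 A) S c.
Proof.
move=> S0 S1 b pe; pose t := tperm i0 i1.
have tS i : i \in S -> t i = i.
  move=> iS; rewrite /t tpermD//; [apply: contraNneq S0|apply: contraNneq S1];
    by move->.
have tN i : i \notin S -> t i \notin S.
  by rewrite /t; case: tpermP.
have tb i : blk I (t i) = blk I i by rewrite /t; case: tpermP => // ->.
case: pe => h1 h2 h3 h4 h5 h6 h7; split=> //.
- by move=> i iS; rewrite mxE tS// h2.
- by move=> i j iS ji; rewrite mxE tS// h3.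
- by move=> i j /tN iS ji; rewrite mxE h4.
- move=> i i' iS le ne; rewrite mxE h5 ?tb//.
  by apply: contra_neq ne => e; apply: (@perm_inj _ t); rewrite (tS i').
Qed.

Lemma partial_echelon_step m A S c : (m < n)%N -> A \in unitmx ->
  partial_echelon m A S c ->
  exists A' S' c', peq I A' A /\ partial_echelon m.+1 A' S' c'.
Proof.
move=> mn UA pe; pose x := Ordinal mn.
have [/existsP[i /andP[iS ix]]|/existsPn no] :=
    boolP [exists i, (i \notin S) && (red (A i x) != 0)]; last first.
  exists A, S, c; split; first exact: peq_refl.
  case: pe => h1 h2 h3 h4 h5 h6 h7; split=> //.
    by move=> i /h1/ltnW.
  move=> i j iS; rewrite ltnS leq_eqVlt => /predU1P[e|/h4->//].
  by have := no i; rewrite iS negbK /= => /eqP; rewrite (_ : x = j)//; apply: val_inj.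
have pix : (i \notin S) && (red (A i x) != 0) by rewrite iS.
case: (arg_maxnP (fun j => blk I j) (i0 := i)
  (P := fun i => (i \notin S) && (red (A i x) != 0)) pix) => i1 /andP[S1 x1] max1.
have p0 : (i1 \notin S) && (blk I i1 == blk I i1) by rewrite S1 eqxx.
case: (arg_minnP (fun j : 'I_n => val j) (i0 := i1)
  (P := fun i => (i \notin S) && (blk I i == blk I i1)) p0)
  => i0 /andP[S0 /eqP b0] min0.
set A1 := xrow i0 i1 A.
have pe1 : partial_echelon m A1 S c by exact: partial_echelon_swap.
have peq1 : peq I A1 A by exact: peq_swap.
have A1x : red (A1 i0 x) != 0 by rewrite mxE tpermL.
have out j : j \notin S -> (blk I i0 < blk I j)%N -> red (A1 j x) = 0.
  move=> jS lt; apply/eqP; apply: contraTT lt; rewrite -leqNgt b0 mxE => ne.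
  case: tpermP ne => [->//|->//|_ _ ne]; first by rewrite b0.
  by apply: max1; rewrite jS.
have Uu : A1 i0 x \is a GRing.unit by rewrite (red_unit hd hred).
exists (pivot I A1 i0 x), (i0 |: S)%SET, (fun i => if i == i0 then x else c i).
split; first exact: peq_trans (peq_pivot _ Uu) peq1.
case: pe1 => h1 h2 h3 h4 h5 h6 h7.
have ne0 j : j \in S -> (j == i0) = false.
  by move=> jS; apply: contraNF S0 => /eqP <-.
have low j (l : 'I_n) : (l < m)%N -> red (pivot I A1 i0 x j l) = red (A1 j l).
  by move=> lm; rewrite mxE rmorphD rmorphM/= (h4 i0)// mulr0 addr0.
have colx j : j \notin S -> j != i0 -> red (pivot I A1 i0 x j x) = 0.
  move=> jS jn; have [le|lt] := leqP (blk I j) (blk I i0).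
    by rewrite pivot_col// (negPf jn) rmorph0.
  by rewrite pivot_below// out.
split.
- move=> j; rewrite finset.in_setU1; case: eqP => [_ _|_ /= /h1/ltnW//].
  exact: ltnSn.
- move=> j; rewrite finset.in_setU1; case: eqP => [-> _|_ /= jS].
    by rewrite pivot_col// eqxx rmorph1.
  by rewrite low ?h2// h1.
- move=> j l; rewrite finset.in_setU1; case: eqP => [-> _ /= lx|_ /= jS lc].
    by rewrite low// h4.
  by rewrite low ?h3// (ltn_trans lc)// h1.
- move=> j l; rewrite finset.in_setU1 negb_or => /andP[jn jS].
  rewrite ltnS leq_eqVlt => /predU1P[e|lm]; last by rewrite low// h4.
  by rewrite (_ : l = x) ?colx//; apply: val_inj.
- move=> j j'; rewrite finset.in_setU1; case: eqP => [-> _ le ne|_ /= jS le ne].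
    by rewrite pivot_col// (negPf ne) rmorph0.
  by rewrite low ?h5// h1.
- move=> j j'; rewrite !finset.in_setU1.
  case: (j =P i0) => [->|_]; case: (j' =P i0) => [->|_] /=; rewrite ?ltnn//.
    by move=> _ j'S b lt; move: S0; rewrite (h7 i0 j').
  + by move=> jS _ _ _; exact: h1.
  + exact: h6.
- move=> j j'; rewrite !finset.in_setU1; case: (j' =P i0) => [->|_] /=.
    move=> _ b lt; apply/orP; right; apply: contraLR lt => jS.
    by rewrite -leqNgt min0// jS b b0 eqxx.
  by move=> j'S b lt; rewrite (h7 j j') ?orbT.
Qed.

Lemma partial_echelon_exists m A : (m <= n)%N -> A \in unitmx ->
  exists A' S c, peq I A' A /\ partial_echelon m A' S c.
Proof.
elim: m => [_ UA|m IH mn UA].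
  exists A, finset.set0, id; split; first exact: peq_refl.
  by split=> [i|i|i j|i j|i i'|i i'|i i']; rewrite ?finset.in_set0.
have [A1 [S1 [c1 [e1 p1]]]] := IH (ltnW mn) UA.
have [A2 [S2 [c2 [e2 p2]]]] := partial_echelon_step mn (peq_unit e1 UA) p1.
by exists A2, S2, c2; split=> //; exact: peq_trans e2 e1.
Qed.

(** The row operations are carried out over [o], although only residues are brought to echelon form,
    because [peq] over [o] is what keeps the lattice unchanged. *)
Lemma echelon_exists A : A \in unitmx ->
  exists A' c, peq I A' A /\ echelon I (map_mx red A') c.
Proof.
move=> UA; have [A' [S [c [e p]]]] := partial_echelon_exists (leqnn n) UA.
exists A', c; split=> //; have UA' := peq_unit e UA.
(* A row without pivot vanishes modulo pi, which an invertible matrix does not allow. *)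
have ST i : i \in S.
  apply: contraT => iS.
  have := congr1 (fun M : 'M[o]_n => red (M i i)) (mulmxV UA').
  rewrite !mxE eqxx rmorph1 rmorph_sum big1 => [/esym/eqP|j _].
    by rewrite oner_eq0.
  by rewrite rmorphM/= (pe_out p)// mul0r.
split=> [i|i j|i i'|i i'].
- by rewrite mxE (pe_one p).
- by rewrite mxE => /(pe_left p) ->.
- by rewrite mxE => le ne; exact: (pe_zero p).
- exact: (pe_mono p).
Qed.

(* Clearing the entries above the block diagonal from the last column to the
   first never disturbs the columns already cleared. *)
Lemma block_clear A : in_L I (map_mx red A) ->
  exists B, [/\ peq I B A, map_mx red B = map_mx red A & in_L I B].
Proof.
move=> LE; suff H d : exists B, [/\ peq I B A, map_mx red B = map_mx red A &
    forall i j : 'I_n, (n - d <= j)%N -> (blk I i <= blk I j)%N ->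
      B i j = (i == j)%:R].
  have [B [? ? h]] := H n; exists B; split=> //; apply: in_L_of_entries => i j.
  by apply: h; rewrite subnn.
elim: d => [|d [B [e rB h]]].
  exists A; split=> //; first exact: peq_refl.
  by move=> i j; rewrite subn0 leqNgt ltn_ord.
have [dn|nd] := ltnP d n; last first.
  exists B; split=> // i j _; apply: h; rewrite leq_subLR.
  exact: leq_trans nd (leq_addr _ _).
have lt : (n - d.+1 < n)%N by rewrite ltn_subrL (leq_trans _ dn).
pose x := Ordinal lt.
have rBe i j : red (B i j) = map_mx red A i j by rewrite -rB mxE.
have Uu : B x x \is a GRing.unit.
  by rewrite (red_unit hd hred) rBe (in_L_entry LE)// eqxx oner_neq0.
exists (pivot I B x x); split; first exact: peq_trans (peq_pivot _ Uu) e.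
- rewrite -rB; apply/matrixP => i j; rewrite [LHS]mxE [RHS]mxE mxE rmorphD rmorphM/=.
  rewrite [X in _ + X * _](_ : _ = 0) ?mul0r ?addr0// /pivot_coef.
  case: eqP => [_|/eqP ne].
    rewrite rmorphB rmorphV//= rmorph1 rBe (in_L_entry LE)// eqxx invr1.
    by rewrite subrr.
  case: ifP => le; last exact: rmorph0.
  rewrite rmorphN rmorphM/= rBe (in_L_entry LE)// (negPf ne) mul0r.
  by rewrite oppr0.
- move=> i j; rewrite leq_eqVlt => /predU1P[ej|ltj] le.
    have <- : x = j by apply: val_inj.
    apply: pivot_col => //; move: le; rewrite (_ : j = x)//.
    by apply/esym/val_inj.
  have xj : (x < j)%N := ltj.
  rewrite subnSK// in ltj.
  rewrite pivot_id; first exact: h.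
  by rewrite h// ?blk_homo ?ord_ltF// ltnW.
Qed.

(** The echelon form determines the permutation; once its pivots are on the diagonal, [block_clear]
    makes the part on and above the block diagonal exact without changing residues. Column
    permutations commute with row operations. *)
Lemma lower_block_form A : A \in unitmx ->
  exists A' (s : 'S_n) B, [/\ peq I A' A, in_L I B, A' = col_perm s B &
    in_RI I (col_perm s (map_mx red B))].
Proof.
move=> UA; have [A1 [c [e ech]]] := echelon_exists UA.
pose s := perm (ech_inj ech); have sc : s =1 c by exact: permE.
have UA1 := peq_unit e UA.
have UrA1 : map_mx red A1 \in unitmx.
  by rewrite unitmxE det_map_mx rmorph_unit// -unitmxE.
have LE := echelon_col_perm UrA1 ech sc; rewrite -map_col_perm in LE.
have [B [eB rB LB]] := block_clear LE.
exists (col_perm s^-1 B), s^-1%g, B; split=> //.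
  apply: peq_trans e; case: eB => g [Ug Pg ->]; exists g; split=> //.
  by rewrite !col_permE mulmxA -!mulmxA -perm_mxM mulgV perm_mx1 mulmx1.
rewrite rB map_col_perm -col_permM mulVg col_perm1.
by apply/in_RIP; split=> //; exists c.
Qed.

End Elimination.

(** * Counting lattices of a given type *)

Section FiniteSets.
Local Open Scope nat_scope.

Lemma card_fset_set_bigcup (T : choiceType) (J : finType) (Q : pred J)
  (F : J -> set T) : (forall j, Q j -> finite_set (F j)) ->
  (forall i j x, Q i -> Q j -> F i x -> F j x -> i = j) ->
  #|` fset_set (\bigcup_(j in [set j | Q j]) F j)%classic|%fset =
  \sum_(j | Q j) #|` fset_set (F j)|%fset.
Proof.
move=> finF disj; set X := \bigcup_(j in _) _.
have finX : finite_set X by apply: bigcup_finite => //; exact: finite_finset.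
rewrite card_fset_sum1 [LHS]big_seq.
rewrite (eq_bigr (fun x => \sum_(j | Q j) (x \in fset_set (F j)))); last first.
  move=> x; rewrite in_fset_set// inE => -[j /= Qj Fjx].
  rewrite (bigD1 j)//= (in_fset_set (finF j Qj)) mem_set// big1 ?addn0// => i /andP[Qi ij].
  rewrite (in_fset_set (finF i Qi)) memNset// => Fix.
  by rewrite (disj i j x) ?eqxx in ij.
rewrite -big_seq exchange_big/=; apply: eq_bigr => j Qj.
rewrite (eq_bigr (fun x => if x \in fset_set (F j) then 1 else 0)); last first.
  by move=> x _; case: (_ \in _).
rewrite card_fset_sum1 -big_mkcond/= big_fset_condE; congr (\sum_(_ <- enum_fset _) 1).
apply/fsetP => x; rewrite !inE /=.
case: (boolP (x \in fset_set (F j))); rewrite ?andbT ?andbF// => xF.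
rewrite in_fset_set// mem_set//; exists j => //.
by rewrite (in_fset_set (finF j Qj)) inE in xF.
Qed.

Lemma finite_image_factor (T U : Type) (K : finType) (A : set T) (f : T -> U)
  (g : T -> K) : (forall x y, A x -> A y -> g x = g y -> f x = f y) ->
  finite_set (f @` A).
Proof.
move=> fg; pose S := g @` A.
have finS : finite_set S by exact: finite_finset.
have ex (d : {d : K | d \in S}) : exists x, A x /\ g x = val d.
  by have := valP d; rewrite inE => -[x Ax <-]; exists x.
pose h d := f (projT1 (cid (ex d))).
apply: (@sub_finite_set _ _ (h @` setT)); last exact/finite_image/finite_finset.
move=> y [x Ax <-]; have gx : g x \in S by apply/mem_set; exists x.
exists (exist _ (g x) gx) => //; rewrite /h; case: cid => x' /= [Ax' e].
exact: fg.
Qed.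

End FiniteSets.

Lemma sum_distr3 (A : comNzRingType) n (a b y : 'I_n -> A) (M : 'M[A]_n) :
  \sum_l (\sum_i a i * M i l) * (\sum_i b i * M i l) * y l
  = \sum_i \sum_i' a i * b i' * \sum_l M i l * M i' l * y l.
Proof.
under eq_bigr => l _.
  rewrite mulr_suml mulr_suml.
  under eq_bigr => i _ do rewrite mulr_sumr mulr_suml.
  over.
rewrite exchange_big/=; apply: eq_bigr => i _.
rewrite exchange_big/=; apply: eq_bigr => i' _.
rewrite mulr_sumr; apply: eq_bigr => l _.
by rewrite mulrACA !mulrA.
Qed.

Section Lattices.
Variables (o : topIdomainType) (pi : o) (hd : is_dvr pi).
Variables (n : nat) (I : {set 'I_n}).
Implicit Types (A B g : 'M[o]_n) (r : {ffun Idx I -> nat}) (L : set 'rV[o]_n).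

Definition lattice (r0 : nat) r B : set 'rV[o]_n :=
  rowspan (pi ^+ r0 *: (Dmx pi r *m B)).

Definition mul_closed L : Prop := forall u v, L u -> L v -> L (map2_mx *%R u v).

Lemma lattice_entry (r0 : nat) r B i j :
  (pi ^+ r0 *: (Dmx pi r *m B)) i j = pi ^+ (r0 + dwt r i) * B i j.
Proof. by rewrite mxE mul_diag_mx !mxE exprD mulrA. Qed.

Lemma rowspan_unit_mul (U M : 'M[o]_n) : U \in unitmx -> rowspan (U *m M) = rowspan M.
Proof.
move=> UU; apply/seteqP; split=> v /= [w _ <-].
  by exists (w *m U) => //; rewrite mulmxA.
by exists (w *m invmx U) => //; rewrite mulmxA mulmxKV.
Qed.

Lemma rowspan_eq (M M' : 'M[o]_n) : rowspan M' = rowspan M -> exists U, M' = U *m M.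
Proof.
move=> e; have ex i : exists u, u *m M = row i M'.
  have : rowspan M' (row i M') by exists (delta_mx 0 i) => //; rewrite rowE.
  by rewrite e => -[u _ uM]; exists u.
exists (\matrix_i (projT1 (cid (ex i)))).
apply/row_matrixP => i; rewrite row_mul rowK.
by case: cid.
Qed.

Lemma in_latticeP (r0 : nat) r B v : B \in unitmx ->
  lattice r0 r B v <->
  forall j, rdivides (pi ^+ (r0 + dwt r j)) ((v *m invmx B) 0 j).
Proof.
move=> UB; split=> [[w _ <-] j|H].
  rewrite -scalemxAr -scalemxAl mulmxA mulmxK// mul_mx_diag !mxE exprD.
  by exists (w 0 j); rewrite mulrCA.
pose w := \row_j projT1 (cid (H j)).
exists w => //; apply: (can_inj (mulmxKV UB)).
apply/rowP => j; rewrite -scalemxAr -scalemxAl mulmxA mulmxK// mul_mx_diag !mxE.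
by case: cid => c /= ->; rewrite !mxE exprD mulrCA.
Qed.

Definition par r g := forall i j, (blk I j < blk I i)%N ->
  rdivides (pi ^+ ewt r i j) (g i j).

Lemma bup_par r g : bup I g -> par r g.
Proof. by move=> Pg i j /Pg ->; exact: rdivides0. Qed.

(** The (i, j) entry of D g D^-1 is g_ij times pi to the power [dwt i - dwt j], negative only when
    [j] lies in an earlier block. As D is not invertible over [o], integrality of the conjugate is
    stated through [U]. *)
Lemma par_conj r g : par r g <-> exists U, Dmx pi r *m g = U *m Dmx pi r.
Proof.
split=> [Pg|[U e] i j ji]; last first.
  have := congr1 (fun M : 'M[o]_n => M i j) e.
  rewrite /= mul_diag_mx mul_mx_diag !mxE -/(dwt r i) -/(dwt r j).
  rewrite (dwt_ewt r (ltnW (blk_lt ji))) exprD mulrCA.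
  by move/(mulfI (dvr_expi_neq0 hd _)) => ->; exists (U i j).
have ex i j : exists u, pi ^+ dwt r i * g i j = u * pi ^+ dwt r j.
  have [le|lt] := leqP (blk I i) (blk I j).
    exists (pi ^+ (dwt r i - dwt r j) * g i j).
    by rewrite mulrAC -exprD subnK ?dwt_le.
  have [c ->] := Pg _ _ lt; exists c.
  by rewrite (dwt_ewt r (ltnW (blk_lt lt))) exprD mulrCA.
exists (\matrix_(i, j) projT1 (cid (ex i j))).
apply/matrixP => i j; rewrite mul_diag_mx mul_mx_diag !mxE.
by case: cid => u /= <-.
Qed.

Lemma det_Dmx_neq0 r : \det (Dmx pi r) != 0.
Proof.
rewrite det_diag; apply/prodf_neq0 => i _; rewrite mxE.
exact: dvr_expi_neq0.
Qed.

(** The conjugate [U] of [g] by D is integral with the same determinant as [g], hence invertible,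
    and it only changes the basis of the lattice. *)
Lemma lattice_par (r0 : nat) r g B : g \in unitmx -> par r g ->
  lattice r0 r (g *m B) = lattice r0 r B.
Proof.
move=> Ug /par_conj[U e]; rewrite /lattice mulmxA e -mulmxA scalemxAr.
apply: rowspan_unit_mul; rewrite unitmxE.
have /(congr1 determinant) := e; rewrite !det_mulmx mulrC => /(mulIf (det_Dmx_neq0 r)) <-.
by rewrite -unitmxE.
Qed.

Lemma lattice_eq_par (r0 : nat) r A B : B \in unitmx -> lattice r0 r A = lattice r0 r B ->
  par r (A *m invmx B).
Proof.
move=> UB /rowspan_eq[U e]; apply/par_conj; exists U.
rewrite mulmxA; apply: (can_inj (mulmxK UB)); rewrite mulmxKV//.
move: e; rewrite -scalemxAr mulmxA => e.
apply/matrixP => i j; have := congr1 (fun M : 'M[o]_n => M i j) e.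
by rewrite [LHS]mxE [RHS]mxE => /(mulfI (dvr_expi_neq0 hd _)).
Qed.

Lemma lattice_peq (r0 : nat) r A B : peq I A B -> lattice r0 r A = lattice r0 r B.
Proof. by move=> [g [Ug Pg ->]]; apply: lattice_par => //; exact: bup_par. Qed.

Definition mcong N A B := forall i j, rdivides (pi ^+ N) (A i j - B i j).

Lemma mcong_mulr N A B C : mcong N A B -> mcong N (A *m C) (B *m C).
Proof.
move=> AB i j; rewrite !mxE -sumrB; apply: rdivides_sum => l _.
by rewrite -mulrBl; apply: rdivides_mulr.
Qed.

Lemma mcong_mull N A B C : mcong N A B -> mcong N (C *m A) (C *m B).
Proof.
move=> AB i j; rewrite !mxE -sumrB; apply: rdivides_sum => l _.
by rewrite -mulrBr; apply: rdivides_mull.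
Qed.

Lemma mcong_par N r A B : B \in unitmx -> (\sum_iota r iota <= N)%N ->
  mcong N A B -> par r (A *m invmx B).
Proof.
move=> UB rN /mcong_mulr-/(_ (invmx B)); rewrite mulmxV// => c i j ji.
have := c i j; rewrite mxE [in X in _ - X]mxE (blk_ltF ji) subr0.
by apply: rdivides_trans; apply: rdivides_exp (leq_trans (ewt_le _ _ _) rN).
Qed.

(** Gamma contains all matrices congruent to 1 modulo [pi ^+ N], because [N] bounds every [ewt].
    Hence only finitely many lattices of a given type arise. *)
Lemma lattice_mcong N (r0 : nat) r A B : A \in unitmx -> B \in unitmx ->
  (\sum_iota r iota <= N)%N -> mcong N A B -> lattice r0 r A = lattice r0 r B.
Proof.
move=> UA UB rN c; rewrite -[A](mulmxKV UB); apply: lattice_par.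
  by rewrite unitmx_mul UA unitmx_inv.
exact: mcong_par c.
Qed.

(** By bilinearity it suffices to multiply generators. In the coordinates given by B^-1, the product
    of rows [i] and [i'] carries the factor [pi ^+ (r0 + dwt r i)]; cancelling it against
    [pi ^+ (r0 + dwt r j)] leaves [ewt r i j]. The sum stops at [i] because [B] is lower
    triangular. *)
Lemma mul_closed_latticeP (r0 : nat) r B : in_L I B ->
  mul_closed (lattice r0 r B) <->
  forall j i i' : 'I_n, (j < i)%N -> (i <= i')%N ->
    rdivides (pi ^+ ewt r i j) (pi ^+ r0 * pi ^+ dwt r i' *
      \sum_(l < n | (l <= i)%N) B i l * B i' l * invmx B l j).
Proof.
move=> LB; have UB := in_L_unit LB.
pose M := pi ^+ r0 *: (Dmx pi r *m B).
pose y i i' j := \sum_l B i l * B i' l * invmx B l j.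
have yC i i' j : y i i' j = y i' i j.
  by apply: eq_bigr => l _; rewrite [B i l * _]mulrC.
have yM i i' j : \sum_l M i l * M i' l * invmx B l j =
    pi ^+ (r0 + dwt r i) * (pi ^+ (r0 + dwt r i') * y i i' j).
  rewrite /y !mulr_sumr; apply: eq_bigr => l _.
  by rewrite !lattice_entry mulrACA -!mulrA.
have yl (i i' j : 'I_n) : \sum_(l < n | (l <= i)%N) B i l * B i' l * invmx B l j = y i i' j.
  rewrite /y [RHS](bigID (fun l : 'I_n => (l <= i)%N))/= [X in _ = _ + X]big1 ?addr0//.
  by move=> l; rewrite -ltnNge => il; rewrite (in_L_upper LB il) !mul0r.
have key (i i' j : 'I_n) : (j < i)%N ->
    rdivides (pi ^+ (r0 + dwt r j))
      (pi ^+ (r0 + dwt r i) * (pi ^+ (r0 + dwt r i') * y i i' j)) <->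
    rdivides (pi ^+ ewt r i j) (pi ^+ r0 * pi ^+ dwt r i' * y i i' j).
  move=> ji; rewrite (dwt_ewt r (ltnW ji)) addnA exprD.
  by rewrite rdivides_mulIr ?dvr_expi_neq0// exprD.
split=> [cl j i i' ji ii'|H u v].
  rewrite yl; apply/key => //.
  have rowL l : lattice r0 r B (row l M) by exists (delta_mx 0 l) => //; rewrite rowE.
  have /(in_latticeP _ _ _ UB)/(_ j) := cl _ _ (rowL i) (rowL i').
  by rewrite mxE -yM; under eq_bigr => l _ do rewrite mxE [row i M _ _]mxE [row i' M _ _]mxE.
move=> [a _ <-] [b _ <-]; apply/in_latticeP => // j.
rewrite mxE; under eq_bigr => l _ do rewrite 3!mxE.
rewrite (sum_distr3 (fun i => a 0 i) (fun i => b 0 i) (fun l => invmx B l j) M).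
apply: rdivides_sum => i _; apply: rdivides_sum => i' _; apply: rdivides_mull.
rewrite yM.
wlog ii' : i i' / (i <= i')%N.
  move=> hw; have [/hw//|/ltnW/hw] := leqP i i'.
  by rewrite yC mulrCA.
(* For [i <= j] the factor from row [i] alone is divisible by the required power, so these indices
   impose no condition. *)
have [ji|ij] := ltnP j i; first by apply/key => //; rewrite -yl; exact: H.
apply: rdivides_mulr; apply: rdivides_exp; rewrite leq_add2l.
exact: dwt_le (blk_homo _ ij).
Qed.

Variables (k : finFieldType) (red : {rmorphism o -> k}).
Hypothesis hred : is_residue_map pi red.

Definition mdigits N (m : nat) (M : 'M[o]_(m, n)) :
    {ffun 'I_m * 'I_n -> {ffun 'I_N -> k}} :=
  [ffun p => digits hred N (M p.1 p.2)].

Lemma mdigits_eqP N m (M M' : 'M[o]_(m, n)) : mdigits N M = mdigits N M' <->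
  forall i j, rdivides (pi ^+ N) (M i j - M' i j).
Proof.
split=> [/ffunP e i j|H].
  by apply/(digits_eqP hd hred); have := e (i, j); rewrite !ffunE.
by apply/ffunP => -[i j]; rewrite !ffunE; apply/digits_eqP.
Qed.

Lemma is_subalgebra_lattice (r0 : nat) r B : B \in unitmx ->
  is_subalgebra (lattice r0 r B) <-> mul_closed (lattice r0 r B).
Proof.
move=> UB; split=> [[]//|cl]; split=> //.
- by exists 0 => //; rewrite mul0mx.
- move=> a _ _ [u _ <-] [v _ <-]; exists (a *: u + v) => //.
  by rewrite mulmxDl -scalemxAl.
(* The lattice contains all multiples of [pi ^+ N], so a coset is determined by the first [N] digits
   of a representative: the index is finite. *)
- pose N := (r0 + \sum_iota r iota)%N.
  apply: (finite_image_factor (g := @mdigits N 1)) => u u' _ _ /mdigits_eqP e.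
  have sub (v v' : 'rV[o]_n) : (forall i j, rdivides (pi ^+ N) (v i j - v' i j)) ->
      [set v + w | w in lattice r0 r B] `<=` [set v' + w | w in lattice r0 r B].
    move=> {}e _ [w Lw <-]; exists (v - v' + w); last by rewrite addrA addrCA subrr addr0.
    apply/in_latticeP => // j; rewrite mulmxDl mxE.
    apply: rdividesD; last by have /in_latticeP := Lw; exact.
    apply: (@rdivides_trans _ _ (pi ^+ N)).
      by apply: rdivides_exp; rewrite leq_add2l dwt_le_sum.
    rewrite mxE; apply: rdivides_sum => l _; apply: rdivides_mulr.
    by rewrite !mxE; exact: e.
  apply/seteqP; split; apply: sub => // i j.
  by rewrite -opprB; apply: rdividesN.
Qed.

Definition perm_lattice (s : 'S_n) L : set 'rV[o]_n := [set col_perm s v | v in L].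

Lemma lattice_col_perm (r0 : nat) r s B :
  lattice r0 r (col_perm s B) = perm_lattice s (lattice r0 r B).
Proof.
rewrite /lattice /perm_lattice col_permE mulmxA scalemxAl.
apply/seteqP; split=> v /= [w].
  by move=> _ <-; exists (w *m (pi ^+ r0 *: (Dmx pi r *m B)));
    [exists w|rewrite col_permE mulmxA].
by move=> [u _ <-] <-; exists u => //; rewrite mulmxA col_permE.
Qed.

Lemma perm_latticeK s : cancel (perm_lattice s) (perm_lattice s^-1).
Proof.
move=> L; rewrite /perm_lattice image_comp; apply/seteqP; split=> v /=.
  by move=> [w Lw <-]; rewrite /= -col_permM mulVg col_perm1.
by move=> Lv; exists v => //; rewrite /= -col_permM mulVg col_perm1.
Qed.

Lemma mul_closed_perm s L : mul_closed L -> mul_closed (perm_lattice s L).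
Proof.
move=> cl _ _ [u Lu <-] [v Lv <-]; exists (map2_mx *%R u v); first exact: cl.
by apply/matrixP => i j; rewrite !mxE.
Qed.

Lemma mul_closed_permE s L : mul_closed (perm_lattice s L) <-> mul_closed L.
Proof.
split; last exact: mul_closed_perm.
by move/(@mul_closed_perm s^-1); rewrite perm_latticeK.
Qed.

Definition subalg_rep (r0 : nat) r (E : 'M[k]_n) : set 'M[o]_n :=
  [set B | [/\ in_L I B, map_mx red B = E & mul_closed (lattice r0 r B)]].

Definition lattice_count (r0 : nat) r (E : 'M[k]_n) : nat :=
  #|` fset_set (lattice r0 r @` subalg_rep r0 r E)|%fset.

Lemma finite_lattices (r0 : nat) r E : finite_set (lattice r0 r @` subalg_rep r0 r E).
Proof.
apply: (finite_image_factor (g := @mdigits (\sum_iota r iota) n)).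
move=> x y [Lx _ _] [Ly _ _] /mdigits_eqP c.
by apply: lattice_mcong c; rewrite ?leqnn// (@in_L_unit _ I).
Qed.

(** Equal lattices differ by an element of Gamma. All [r iota] being positive, Gamma reduces modulo
    pi to block upper triangular matrices, so the two residues are representatives in R_I of one
    coset; [echelon_unique] and then [col_perm_in_L_inj] identify the data. *)
Lemma lattice_form_unique (r0 : nat) r (s s' : 'S_n) B B' :
  (forall iota, (0 < r iota)%N) -> in_L I B -> in_L I B' ->
  in_RI I (col_perm s (map_mx red B)) -> in_RI I (col_perm s' (map_mx red B')) ->
  lattice r0 r (col_perm s B) = lattice r0 r (col_perm s' B') ->
  s = s' /\ map_mx red B = map_mx red B'.
Proof.
move=> r1 LB LB' /in_RIP[_ [c ech]] /in_RIP[_ [c' ech']] e.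
have UB' : col_perm s' B' \in unitmx.
  by rewrite col_permE unitmx_mul (in_L_unit LB') unitmx_perm.
apply: (@col_perm_in_L_inj _ I); [exact: in_L_map|exact: in_L_map|].
have P := lattice_eq_par UB' e.
apply: (echelon_unique (g := map_mx red (col_perm s B *m invmx (col_perm s' B')))
  ech' ech).
  move=> i j ji; rewrite mxE; apply/(red_eq0 hred).
  apply: rdivides_trans (P i j ji).
  by rewrite -[pi in rdivides pi]expr1; apply/rdivides_exp/ewt_gt0.
by rewrite -!map_col_perm -map_mxM mulmxKV.
Qed.

Lemma hcount_sum (r0 : nat) r : (forall iota, (0 < r iota)%N) ->
  hcount pi r0 r = (\sum_(E : 'M[k]_n | in_L I E) tau I E * lattice_count r0 r E)%N.
Proof.
move=> r1; rewrite /hcount.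
pose Q (p : 'M[k]_n * 'S_n) := in_L I p.1 && in_RI I (col_perm p.2 p.1).
pose F (p : 'M[k]_n * 'S_n) :=
  perm_lattice p.2 @` (lattice r0 r @` subalg_rep r0 r p.1).
have -> : [set L | is_subalgebra L /\ has_type pi L r0 r] =
    \bigcup_(p in [set p | Q p]) F p.
  apply/seteqP; split=> L /=.
    move=> [sub [A UA LA]].
    have [A' [s [B [e LB A'B R]]]] := lower_block_form hd hred I UA.
    have LE : L = perm_lattice s (lattice r0 r B).
      by rewrite -lattice_col_perm -A'B (lattice_peq _ _ e).
    exists (map_mx red B, s); first by rewrite /= /Q /= (in_L_map _ LB).
    exists (lattice r0 r B) => //; exists B => //; split=> //.
    apply/(mul_closed_permE s); rewrite -LE LA.
    by apply/(is_subalgebra_lattice _ _ UA); rewrite /lattice -LA.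
  move=> [[E s] /andP[/= LE R] [_ [B [LB _ cl] <-] <-]].
  have UB : col_perm s B \in unitmx.
    by rewrite col_permE unitmx_mul (in_L_unit LB) unitmx_perm.
  rewrite -lattice_col_perm; split; last by exists (col_perm s B).
  by apply/is_subalgebra_lattice; rewrite // lattice_col_perm; apply/mul_closed_permE.
have finF p : finite_set (F p) by apply/finite_image/finite_lattices.
rewrite card_fset_set_bigcup//; last first.
  move=> [E s] [E' s'] L /andP[/= LE R] /andP[/= LE' R'].
  move=> [_ [B [LB /= rB _] <-] <-] [_ [B' [LB' /= rB' _] <-]].
  rewrite /= -!lattice_col_perm => /esym e.
  rewrite -rB in R *; rewrite -rB' in R' *.
  by have [-> ->] := lattice_form_unique r1 LB LB' R R' e.
rewrite (eq_bigr (fun p => lattice_count r0 r p.1)); last first.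
  move=> [E s] _ /=; rewrite /F fset_set_image; last exact: finite_lattices.
  by rewrite card_imfset//; exact: can_inj (@perm_latticeK s).
rewrite -(pair_big_dep (fun E => in_L I E) (fun E s => in_RI I (col_perm s E))
  (fun E s => lattice_count r0 r E))/=.
by apply: eq_bigr => E _; rewrite sum_nat_const.
Qed.

End Lattices.

(** * Haar measures of spheres and of cosets of lattices *)

Section DigitMeasure.
Variables (o : topIdomainType) (pi : o) (hd : is_dvr pi).
Variables (k : finFieldType) (red : {rmorphism o -> k}).
Hypothesis hred : is_residue_map pi red.
Variable R : realType.
Local Notation q := (#|k|%:R : R).

Lemma measure_fin_cells d (T : measurableType d) (mu : {measure set T -> \bar R})
  (K : finType) (P : pred K) (F : K -> set T) :
  trivIset setT F -> (forall i, measurable (F i)) ->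
  measurable (\bigcup_(i in [set i | P i]) F i) /\
  mu (\bigcup_(i in [set i | P i]) F i) = (\sum_(i | P i) mu (F i))%E.
Proof.
move=> tF mF; split.
  by apply: fin_bigcup_measurable => //; exact: finite_finset.
have -> : [set i | P i] = [set` enum P].
  by apply/seteqP; split=> i /=; rewrite mem_enum.
rewrite measure_fin_bigcup//; last exact: sub_trivIset tF.
by rewrite -fsbig_seq ?enum_uniq// big_enum.
Qed.

(** A device for both Haar measures: [c] is any system of coordinates on [G] whose digit cells all
    have one measure [m]. The value of [m] need not be known in advance. *)
Lemma digit_cells_measure d (T : measurableType d) (mu : probability T R)
  (G : set T) (J : finType) (c : T -> J -> o) N (m : \bar R) :
  (forall a : J -> o,
     let cell := [set z | G z /\ forall j, rdivides (pi ^+ N) (c z j - a j)] in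
     measurable cell /\ mu cell = m) ->
  mu G = 1%E ->
  forall P : J -> pred {ffun 'I_N -> k},
    let D := [set z | G z /\ forall j, P j (digits hred N (c z j))] in
    measurable D /\ mu D = (\prod_j (#|P j|%:R / q ^+ N))%:E.
Proof.
move=> hcell G1.
pose F (f : {ffun J -> {ffun 'I_N -> k}}) :=
  [set z | G z /\ forall j, digits hred N (c z j) = f j].
have FP f : measurable (F f) /\ mu (F f) = m.
  pose a j := projT1 (cid (digits_surj hd hred (f j))).
  suff -> : F f = [set z | G z /\ forall j, rdivides (pi ^+ N) (c z j - a j)].
    exact: hcell.
  apply/seteqP; split=> z [Gz H]; split=> // j.
    by apply/(digits_eqP hd hred); rewrite H /a; case: cid.
  by have /(digits_eqP hd hred) -> := H j; rewrite /a; case: cid.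
have tF : trivIset setT F.
  move=> f g _ _ [z [[_ h1] [_ h2]]]; apply/ffunP => j.
  by rewrite -h1 h2.
have DE (P : J -> pred {ffun 'I_N -> k}) :
    [set z | G z /\ forall j, P j (digits hred N (c z j))] =
    \bigcup_(f in [set f : {ffun J -> {ffun 'I_N -> k}} |
       [pred f : {ffun J -> {ffun 'I_N -> k}} | [forall j, P j (f j)]] f]) F f.
  apply/seteqP; split=> z /=.
    move=> [Gz H]; exists [ffun j => digits hred N (c z j)].
      by apply/forallP => j; rewrite ffunE.
    by split=> // j; rewrite ffunE.
  by move=> [f /= /forallP Pf [Gz H]]; split=> // j; rewrite H.
have mfin : m = (fine m)%:E.
  by rewrite fineK// -(hcell (fun=> 0)).2 fin_num_measure//; exact: (hcell _).1.
have muD (P : J -> pred {ffun 'I_N -> k}) :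
    mu [set z | G z /\ forall j, P j (digits hred N (c z j))] =
    ((\prod_j #|P j|%:R) * fine m)%:E.
  rewrite DE (measure_fin_cells mu _ tF (fun f => (FP f).1)).2.
  rewrite (eq_bigr (fun=> (fine m)%:E)) => [|f _]; last by rewrite -mfin; exact: (FP f).2.
  by rewrite sumEFin sumr_const card_ffun_family -natr_prod mulr_natl.
move=> P; split; first by rewrite DE; exact: (measure_fin_cells mu _ tF (fun f => (FP f).1)).1.
(* Allowing all digit strings gives the whole of [G], of mass 1, and so determines [m]. *)
have := muD (fun=> predT); rewrite (_ : [set z | _ z /\ _] = G); last first.
  by apply/seteqP; split=> z //= [].
rewrite G1 => -[one]; rewrite muD; congr (_%:E).
rewrite prodf_div (_ : \prod_(i : J) q ^+ N = \prod_(i : J) #|{: {ffun 'I_N -> k}}|%:R).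
  apply: (canRL (mulfK _)); first by apply: contra_eq_neq one => ->; rewrite mul0r oner_neq0.
  by rewrite -mulrA [fine m * _]mulrC -one mulr1.
by apply: eq_bigr => j _; rewrite card_ffun card_ord natrX.
Qed.

End DigitMeasure.

Section HaarMeasures.
Variables (R : realType) (o : topIdomainType) (pi : o) (ho : is_compact_dvr pi).
Variables (k : finFieldType) (red : {rmorphism o -> k}).
Hypothesis hred : is_residue_map pi red.
Variables (n : nat) (I : {set 'I_n}).
Local Notation q := (#|k|%:R : R).
Let hd : is_dvr pi := cdvr_dvr ho.

Lemma nbhs_ball N (x : o) : nbhs x [set y | rdivides (pi ^+ N) (y - x)].
Proof.
by apply/(cdvr_adic ho); exists N => y /=; rewrite addrAC subrr add0r; exists y; rewrite mulrC.
Qed.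

Lemma open_ball N (a : o) : open [set y | rdivides (pi ^+ N) (y - a)].
Proof.
rewrite openE => x /= xa; rewrite /interior/=; apply: filterS (nbhs_ball N x).
by move=> y /= yx; rewrite -(subrK x y) -addrA; exact: rdividesD.
Qed.

Lemma measurable_borel (T : ptopologicalType) (U : set T) :
  open U -> measurable (U : set (borel T)).
Proof. exact: sub_sigma_algebra. Qed.

Definition Xcoord (x : Xspace I o) (j : 'I_1 + Idx I) : o :=
  if j is inr iota then x.2 iota else x.1.

Lemma measurable_Xball N j (a : o) :
  measurable [set x : Xspace I o | rdivides (pi ^+ N) (Xcoord x j - a)].
Proof.
apply: measurable_borel; rewrite openE => -[x0 x]; rewrite /interior/=.
case: j => [_ /=|iota /=] xa.
  exists ([set y | rdivides (pi ^+ N) (y - a)], setT) => /=; last by move=> y [].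
  by split; [apply: open_nbhs_nbhs; split => //; exact: open_ball|exact: filterT].
exists (setT, proj iota @^-1` [set y | rdivides (pi ^+ N) (y - a)]) => /=.
  split; first exact: filterT.
  apply: (@proj_continuous _ (fun=> o : topologicalType) iota x).
  by apply: open_nbhs_nbhs; split => //; exact: open_ball.
by move=> y [].
Qed.

Lemma measurable_mcong N (A : 'M[o]_n) :
  measurable ([set B | mcong pi N B A] : set (Bspace n o)).
Proof.
apply: measurable_borel; rewrite openE => B BA; rewrite /interior/=.
exists (fun i j => [set y | rdivides (pi ^+ N) (y - A i j)]).
  by move=> i j; apply: open_nbhs_nbhs; split; [exact: open_ball|exact: BA].
by move=> C h i j; exact: h.
Qed.

(** Equality of an entry with 0 or 1 is the conjunction of the congruences modulo all [pi ^+ N],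
    since no nonzero element is divisible by every power; each congruence is an open condition. *)
Lemma measurable_in_L : measurable ([set B | in_L I (B : 'M[o]_n)] : set (Bspace n o)).
Proof.
have -> : [set B | in_L I (B : 'M[o]_n)] =
    \bigcap_N [set B | forall i j, (blk I i <= blk I j)%N ->
      rdivides (pi ^+ N) (B i j - (i == j)%:R)] :> set (Bspace n o).
  apply/seteqP; split=> B /=.
    by move=> LB N _ i j ij; rewrite (in_L_entry LB)// subrr; exact: rdivides0.
  move=> H; apply: in_L_of_entries => i j ij; apply/eqP; rewrite -subr_eq0.
  apply/negPn/negP => /(expi_ndivides hd)[N]; apply.
  exact: H.
apply: bigcapT_measurable => N; apply: measurable_borel.
rewrite openE => B BA; rewrite /interior/=.
exists (fun i j => [set y | (blk I i <= blk I j)%N -> rdivides (pi ^+ N) (y - (i == j)%:R)]).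
  move=> i j; case: (boolP (blk I i <= blk I j)%N) => ij.
    apply: (@filterS _ _ _ [set y | rdivides (pi ^+ N) (y - (i == j)%:R)]).
      by move=> y yx _.
    by apply: open_nbhs_nbhs; split; [exact: open_ball|exact: BA].
  by apply: filterS filterT => y.
by move=> C h i j; exact: h.
Qed.

Section Additive.
Variable mux : probability (Xspace I o) R.
Hypothesis hmux : is_haar (@Xadd n I o) [set: Xspace I o] mux.

Definition sphere (t : nat * {ffun Idx I -> nat}) : set (Xspace I o) :=
  [set x | [/\ x.1 != 0, vald pi x.1 = t.1 &
    forall iota, x.2 iota != 0 /\ vald pi (x.2 iota) = (t.2 iota).-1]].

Lemma sphere_measure t : measurable (sphere t) /\
  mux (sphere t) = (q^-1 ^+ t.1 * (1 - q^-1) *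
    \prod_iota (q^-1 ^+ (t.2 iota).-1 * (1 - q^-1)))%:E.
Proof.
(* A common precision beyond all the prescribed valuations [v j]. *)
pose N := (t.1 + \sum_iota t.2 iota).+1.
pose v (j : 'I_1 + Idx I) := if j is inr iota then (t.2 iota).-1 else t.1.
have vN j : (v j < N)%N.
  rewrite /v ltnS; case: j => [_|iota]; first exact: leq_addr.
  apply: leq_trans (leq_pred _) _; rewrite (bigD1 iota)//= addnCA.
  exact: leq_addr.
pose cell a := [set x | [set: Xspace I o] x /\
  forall j, rdivides (pi ^+ N) (Xcoord x j - a j)].
have mcell a : measurable (cell a).
  have -> : cell a = \bigcap_(j in [set: 'I_1 + Idx I])
      [set x | rdivides (pi ^+ N) (Xcoord x j - a j)].
    apply/seteqP; split=> x /=; first by move=> [_ H] j _; exact: H.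
    by move=> H; split=> // j; exact: H.
  apply: fin_bigcap_measurable => [|j _]; first exact: finite_finset.
  exact: measurable_Xball.
have mucell a : mux (cell a) = mux (cell (fun=> 0)).
  pose g : Xspace I o := (a (inl ord0), fun iota => a (inr iota)).
  rewrite -((hmux.2 g) (cell a))//; congr (mux _).
  apply/seteqP; split=> x /= [_ H]; split=> // j; have := H j.
    case: j => [j|iota] /=; rewrite subr0.
      by rewrite (ord1 j) addrAC subrr add0r.
    by rewrite addrAC subrr add0r.
  case: j => [j|iota] /=; rewrite subr0.
    by rewrite (ord1 j) addrAC subrr add0r.
  by rewrite addrAC subrr add0r.
have [mD muD] := digit_cells_measure hd hred (fun a => conj (mcell a) (mucell a))
  hmux.1 (fun j => @sphere_digits k N (v j)).
have DE : [set z | [set: Xspace I o] z /\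
    forall j, sphere_digits (v j) (digits hred N (Xcoord z j))] = sphere t.
  apply/seteqP; split=> x /=.
    move=> [_ H].
    have /(sphere_digitsP hd _ _ (vN _))[x0 vx] := H (inl ord0).
    split=> // iota.
    by have /(sphere_digitsP hd _ _ (vN _))[] := H (inr iota).
  move=> [x0 vx H]; split=> // -[j|iota]; apply/(sphere_digitsP hd) => //.
  exact: H.
rewrite -DE; split=> //; apply: etrans muD _; congr (_%:E).
rewrite big_sumType/= big_ord1 (sphere_digits_density _ _ (vN (inl ord0))).
by congr (_ * _); apply: eq_bigr => iota _; rewrite (sphere_digits_density _ _ (vN (inr iota))).
Qed.

End Additive.

Section Multiplicative.
Variable muB : probability (Bspace n o) R.
Hypothesis hmuB : is_haar (@Bmul n o) [set B : Bspace n o | in_L I (B : 'M[o]_n)] muB.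

Let lower := {p in [pred p : 'I_n * 'I_n | (blk I p.2 < blk I p.1)%N]}.

Lemma card_ord_lt m : (m <= n)%N -> #|[pred j : 'I_n | (j < m)%N]| = m.
Proof.
move=> mn; rewrite -sum1_card.
by rewrite -(big_ord_widen n (fun=> 1%N) mn) sum1_card card_ord.
Qed.

Lemma card_ord_ge m : (m <= n)%N -> #|[pred i : 'I_n | (m <= i)%N]| = (n - m)%N.
Proof.
move=> mn; rewrite -[in RHS](card_ord n) -(cardC [pred j : 'I_n | (j < m)%N]).
rewrite card_ord_lt// addKn; apply: eq_card => i.
by rewrite !inE -leqNgt.
Qed.

(** Each [r iota] is counted once for every position (i, j) with [j < iota <= i]. There are [iota]
    columns and [n - iota] rows of this kind, and all these positions lie below the block
    diagonal. *)
Lemma sum_ewt (r : {ffun Idx I -> nat}) :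
  (\sum_(p : lower) ewt r (val p).1 (val p).2 =
   \sum_iota r iota * (inat iota * (n - inat iota)))%N.
Proof.
rewrite -(big_sub _ (fun p : 'I_n * 'I_n => ewt r p.1 p.2)).
rewrite (exchange_big_dep xpredT)//=; apply: eq_bigr => iota _.
rewrite (eq_bigl (fun p : 'I_n * 'I_n => (inat iota <= p.1)%N && (p.2 < inat iota)%N));
  last first.
  move=> p; rewrite !inE andbC [RHS]andbC.
  case: (boolP (p.2 < _ <= _)%N) => //= /andP[h1 h2].
  rewrite ltnNge; apply/negP => /blk_leP/(_ h2); rewrite leqNgt h1.
  by [].
rewrite -(pair_big (fun i : 'I_n => (inat iota <= i)%N)
  (fun j : 'I_n => (j < inat iota)%N) (fun _ _ => r iota))/=.
have le : (inat iota <= n)%N by exact: ltnW (ltn_ord (val iota)).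
under eq_bigr => i _ do rewrite sum_nat_const card_ord_lt//.
by rewrite sum_nat_const card_ord_ge// mulnC (mulnC (inat iota) (r iota)) mulnA.
Qed.

(** The coordinates are the entries of B B0^-1 below the block diagonal: in them the coset is a
    product of balls of radii given by [ewt]. *)
Lemma par_measure (r : {ffun Idx I -> nat}) (B0 : 'M[o]_n) : in_L I B0 ->
  let D := [set B : Bspace n o | in_L I (B : 'M[o]_n) /\ par pi r (B *m invmx B0)] in
  measurable D /\
  muB D = (q^-1 ^+ (\sum_iota r iota * (inat iota * (n - inat iota))))%:E.
Proof.
move=> LB0; pose N := (\sum_iota r iota)%N.
pose c (B : Bspace n o) (p : lower) : o := ((B : 'M[o]_n) *m invmx B0) (val p).1 (val p).2.
pose G := [set B : Bspace n o | in_L I (B : 'M[o]_n)].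
pose cell a := [set B | G B /\ forall p, rdivides (pi ^+ N) (c B p - a p)].
pose A (a : lower -> o) : 'M[o]_n := \matrix_(i, j)
  if insub (i, j) is Some p then a p else (i == j)%:R.
have LA a : in_L I (A a).
  apply: in_L_of_entries => i j ij; rewrite mxE insubN//=.
  by rewrite -leqNgt.
have cellE a : cell a = G `&` [set B | mcong pi N B (A a *m B0)].
  have UB0 := in_L_unit LB0.
  have e (B : 'M[o]_n) : in_L I B -> mcong pi N B (A a *m B0) <->
      mcong pi N (B *m invmx B0) (A a).
    move=> LB; split=> /mcong_mulr; first by move/(_ (invmx B0)); rewrite mulmxK.
    by move/(_ B0); rewrite mulmxKV.
  apply/seteqP; split=> B /= [LB H]; split=> //.
    apply/e => // i j; rewrite [X in _ - X]mxE.
    case: insubP => [p _ pij|]; first by have := H p; rewrite /c pij.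
    rewrite -leqNgt /= => ij.
    by rewrite (in_L_entry (in_L_mul LB (in_L_inv LB0)))// subrr; exact: rdivides0.
  move=> p; have /e := H => /(_ LB) /(_ (val p).1 (val p).2).
  by rewrite [X in _ - X]mxE -surjective_pairing valK.
have mG : measurable G by exact: measurable_in_L.
have mcell a : measurable (cell a).
  by rewrite cellE; apply: measurableI => //; exact: measurable_mcong.
(* Rewritten as congruence of [B] itself to [A a *m B0], the cell is the left translate by that
   matrix of the congruence subgroup, so left invariance applies although the coordinates use right
   multiplication. *)
have mucell a : muB (cell a) = muB (G `&` [set B | mcong pi N B 1%:M]).
  have Lg := in_L_mul (LA a) LB0; set g := A a *m B0 in Lg.
  rewrite -((hmuB.2 g) (cell a))//; congr (muB _).
  rewrite cellE -/g; apply/seteqP; split=> B /= [LB H]; split=> //.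
  - by have := in_L_mul (in_L_inv Lg) LB; rewrite /Bmul mulKmx// (in_L_unit Lg).
  - have := mcong_mull (invmx g) H.
    by rewrite /Bmul mulKmx ?(in_L_unit Lg)// mulVmx// (in_L_unit Lg).
  - exact: in_L_mul.
  - by have := mcong_mull g H; rewrite mulmx1.
have [mD muD] := digit_cells_measure hd hred (fun a => conj (mcell a) (mucell a))
  hmuB.1 (fun p => @ball_digits k N (ewt r (val p).1 (val p).2)).
have DE : [set z | G z /\ forall p : lower,
      ball_digits (ewt r (val p).1 (val p).2) (digits hred N (c z p))] =
    [set B : Bspace n o | in_L I (B : 'M[o]_n) /\ par pi r (B *m invmx B0)].
  apply/seteqP; split=> B /= [LB H]; split=> //.
    move=> i j ij; have /(ball_digitsP hd) := H (exist _ (i, j) ij).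
    by apply; exact: ewt_le.
  move=> p; apply/(ball_digitsP hd); first exact: ewt_le.
  exact: H (valP p).
rewrite -DE; split=> //; apply: etrans muD _; congr (_%:E).
rewrite (eq_bigr (fun p : lower => q^-1 ^+ ewt r (val p).1 (val p).2)).
  by rewrite -sum_ewt prodrXr.
by move=> p _; rewrite ball_digits_density// ewt_le.
Qed.

(** The representatives split into fibres over the lattices they span; each fibre is a full coset,
    of volume independent of the lattice. *)
Lemma subalg_rep_measure r0 (r : {ffun Idx I -> nat}) E : (forall iota, (0 < r iota)%N) ->
  measurable (subalg_rep pi red r0 r E : set (Bspace n o)) /\
  muB (subalg_rep pi red r0 r E) = ((lattice_count pi red r0 r E)%:R *
    q^-1 ^+ (\sum_iota r iota * (inat iota * (n - inat iota))))%:E.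
Proof.
move=> r1; set C := subalg_rep _ _ _ _ _; set D := lattice pi r0 r @` C.
have finD : finite_set D by exact: finite_lattices.
pose F L := [set B : Bspace n o | in_L I (B : 'M[o]_n) /\ lattice pi r0 r B = L].
have FE B0 : in_L I B0 -> F (lattice pi r0 r B0) =
    [set B : Bspace n o | in_L I (B : 'M[o]_n) /\ par pi r (B *m invmx B0)].
  move=> LB0; have UB0 := in_L_unit LB0.
  apply/seteqP; split=> B /= [LB H]; split=> //.
    exact: (lattice_eq_par hd UB0 H).
  rewrite -[in LHS](mulmxKV UB0 B); apply: lattice_par => //.
  by rewrite unitmx_mul (in_L_unit LB) unitmx_inv.
have CE : C = \bigcup_(L in D) F L.
  apply/seteqP; split=> B.
    by move=> CB; exists (lattice pi r0 r B); [exists B|case: CB].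
  move=> [_ [B0 [LB0 rB0 cl] <-]] FB; have [LB e] := FB.
  split=> //; last by rewrite e.
  move: FB; rewrite FE// => -[_ P]; rewrite -rB0.
  have UB0 := in_L_unit LB0.
  rewrite -[in LHS](mulmxKV UB0 B) map_mxM.
  (* Matrices spanning the same lattice have the same residue: their quotient is in L_I, hence the
     identity on and above the block diagonal, and in Gamma, hence zero modulo pi below it. *)
  suff -> : map_mx red (B *m invmx B0) = 1%:M by rewrite mul1mx.
  apply/matrixP => i j; rewrite mxE [RHS]mxE.
  have [ij|ji] := leqP (blk I i) (blk I j).
    by rewrite (in_L_entry (in_L_mul LB (in_L_inv LB0)))// rmorph_nat.
  rewrite (blk_ltF ji); apply/(red_eq0 hred); apply: rdivides_trans (P i j ji).
  by rewrite -[pi in rdivides pi]expr1; apply/rdivides_exp/ewt_gt0.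
have FP L : D L -> measurable (F L) /\
    muB (F L) = (q^-1 ^+ (\sum_iota r iota * (inat iota * (n - inat iota))))%:E.
  by move=> [B0 [LB0 _ _] <-]; rewrite FE//; exact: par_measure.
rewrite CE; split; first by apply: fin_bigcup_measurable => // L /FP[].
rewrite measure_fin_bigcup//; last 2 first.
- by move=> L L' _ _ [B [[_ <-] [_ <-]]].
- by move=> L /FP[].
rewrite fsbig_finite//= big_seq (eq_bigr (fun=>
   (q^-1 ^+ (\sum_iota r iota * (inat iota * (n - inat iota))))%:E)); last first.
  by move=> L; rewrite in_fset_set// inE => /FP[].
rewrite -big_seq sumEFin big_const_seq count_predT iter_addr_0 mulr_natl.
by [].
Qed.

End Multiplicative.
End HaarMeasures.

(** * Unordered sums and piecewise constant functions *)

Section RealSums.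
Variables (R : realType) (T : choiceType) (D : set T).
Implicit Types f g h : T -> R.

Definition rsummable f := summable D (fun t => (f t)%:E).

Lemma rsummable_le f g : (forall t, D t -> `|f t| <= g t) -> rsummable g -> rsummable f.
Proof.
move=> fg; apply: le_lt_trans; apply: le_esum => t Dt /=.
by rewrite lee_fin (le_trans (fg t Dt))// ler_norm.
Qed.

Lemma rsummable_eq f g : (forall t, D t -> f t = g t) -> rsummable g -> rsummable f.
Proof.
move=> fg; rewrite /rsummable /summable.
suff -> : (\esum_(t in D) `|(f t)%:E| = \esum_(t in D) `|(g t)%:E|)%E by [].
by apply: eq_esum => t /fg ->.
Qed.

Lemma rsummableD f g : rsummable f -> rsummable g -> rsummable (fun t => f t + g t).
Proof. exact: summableD. Qed.

Lemma ge0_esumZ c f : 0 <= c ->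
  (\esum_(t in D) (c * f t)%:E = c%:E * \esum_(t in D) (f t)%:E)%E.
Proof.
move=> c0; rewrite /esum -ereal_supZl//; last first.
  apply/set0P; exists (\sum_(x \in set0) (f x)%:E)%E, set0 => //.
  exact: fsets_set0.
congr ereal_sup; rewrite image_comp; apply: eq_imagel => A [finA _] /=.
by rewrite !fsbig_finite//= !sumEFin -EFinM mulr_sumr.
Qed.

Lemma rsummableZ c f : rsummable f -> rsummable (fun t => c * f t).
Proof.
move=> sf; rewrite /rsummable /summable.
under eq_esum do rewrite /= normrM.
rewrite ge0_esumZ//; move: sf; rewrite /rsummable summableE => sf.
by rewrite -(fineK sf) -EFinM ltry.
Qed.

Lemma rsummable0 : rsummable (fun=> 0).
Proof. by rewrite /rsummable /summable esum1// => t _; rewrite /= normr0. Qed.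

Lemma ge0_rsummable f : (forall t, D t -> 0 <= f t) -> rsummable f ->
  (\esum_(t in D) (f t)%:E)%E \is a fin_num.
Proof.
move=> f0; rewrite /rsummable summableE (eq_esum (b := fun t => (f t)%:E))// => t Dt.
by rewrite /= ger0_norm ?f0.
Qed.

(** Frees [rsum] from the particular splitting into positive and negative parts; linearity follows
    from convenient decompositions. *)
Lemma rsum_diff f g h : (forall t, D t -> f t = g t - h t) ->
  (forall t, D t -> 0 <= g t) -> (forall t, D t -> 0 <= h t) ->
  rsummable g -> rsummable h ->
  rsum D f = fine (\esum_(t in D) (g t)%:E) - fine (\esum_(t in D) (h t)%:E).
Proof.
move=> fE g0 h0 sg sh; rewrite /rsum.
rewrite -[RHS]fineB ?ge0_rsummable// -(esumB sg sh)// [RHS]fineB//.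
- congr (fine _ - fine _); apply: eq_esum => t Dt /=.
    by rewrite funeposE EFin_max fE.
  by rewrite funenegE EFin_max fE// -EFinN.
- rewrite (eq_esum (b := fun t => (Num.max (f t) 0)%:E)); last first.
    by move=> t Dt; rewrite funeposE EFin_max fE.
  apply: ge0_rsummable => [t _|]; first by rewrite le_max lexx orbT.
  apply: (@rsummable_le _ (fun t => g t + h t)); last exact: rsummableD.
  move=> t Dt; rewrite fE//; have := g0 t Dt; have := h0 t Dt; move=> ? ?.
  by rewrite ger0_norm ?le_max ?lexx ?orbT// ge_max; apply/andP; split; lra.
- rewrite (eq_esum (b := fun t => (Num.max (- f t) 0)%:E)); last first.
    by move=> t Dt; rewrite funenegE EFin_max fE// -EFinN.
  apply: ge0_rsummable => [t _|]; first by rewrite le_max lexx orbT.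
  apply: (@rsummable_le _ (fun t => g t + h t)); last exact: rsummableD.
  move=> t Dt; rewrite fE//; have := g0 t Dt; have := h0 t Dt; move=> ? ?.
  by rewrite ger0_norm ?le_max ?lexx ?orbT// ge_max; apply/andP; split; lra.
Qed.

Lemma rsum_eq f g : (forall t, D t -> f t = g t) -> rsum D f = rsum D g.
Proof. by move=> fg; congr (fine _ - fine _); apply: eq_esum => t /fg ->. Qed.

Lemma rsummable_max f : rsummable f -> rsummable (fun t => Num.max (f t) 0).
Proof.
move=> sf; apply: (@rsummable_le _ (fun t => `|f t|)); last first.
  by rewrite /rsummable /summable; under eq_esum do rewrite /= normr_id.
move=> t _; rewrite ger0_norm ?le_max ?lexx ?orbT//.
by rewrite ge_max ler_norm normr_ge0.
Qed.

Lemma rsummableN f : rsummable f -> rsummable (fun t => - f t).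
Proof.
by move=> sf; apply: rsummable_eq (rsummableZ (-1) sf) => t _; rewrite mulN1r.
Qed.

Lemma maxrB x : Num.max x 0 - Num.max (- x) 0 = x :> R.
Proof.
case: (boolP (0 <= x)) => [x0|]; last rewrite -ltNge => x0.
  by rewrite max_l// max_r ?subr0// oppr_le0.
by rewrite max_r ?(ltW x0)// max_l ?sub0r ?opprK// oppr_ge0 ltW.
Qed.

Lemma maxr0_ge0 (x : R) : 0 <= Num.max x 0.
Proof. by rewrite le_max lexx orbT. Qed.

Lemma rsumD f g : rsummable f -> rsummable g ->
  rsum D (fun t => f t + g t) = rsum D f + rsum D g.
Proof.
move=> sf sg; have := rsummable_max; have := rsummableN => sN sM.
rewrite (@rsum_diff _ (fun t => Num.max (f t) 0 + Num.max (g t) 0)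
  (fun t => Num.max (- f t) 0 + Num.max (- g t) 0)); first last.
- by apply: rsummableD; exact/sM/sN.
- by apply: rsummableD; exact/sM.
- by move=> t _; rewrite addr_ge0 ?maxr0_ge0.
- by move=> t _; rewrite addr_ge0 ?maxr0_ge0.
- by move=> t _; rewrite opprD addrACA !maxrB.
under eq_esum do rewrite EFinD.
under [X in _ - fine X]eq_esum do rewrite EFinD.
have fin h : rsummable h -> (\esum_(t in D) (Num.max (h t) 0)%:E)%E \is a fin_num.
  by move=> sh; apply: ge0_rsummable (sM _ sh) => t _; exact: maxr0_ge0.
rewrite !esumD; try by move=> t _; rewrite lee_fin maxr0_ge0.
rewrite !fineD ?fin ?sN// /rsum.
by rewrite opprD addrACA.
Qed.

Lemma rsumZ c f : rsummable f -> rsum D (fun t => c * f t) = c * rsum D f.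
Proof.
move=> sf; have sM := rsummable_max sf; have sN := rsummable_max (rsummableN sf).
have fin h : rsummable h -> (\esum_(t in D) (Num.max (h t) 0)%:E)%E \is a fin_num.
  by move=> sh; apply: ge0_rsummable (rsummable_max sh) => t _; exact: maxr0_ge0.
have [c0|c0] := leP 0 c.
  rewrite (@rsum_diff _ (fun t => c * Num.max (f t) 0) (fun t => c * Num.max (- f t) 0)).
  - by rewrite !ge0_esumZ// !fineM ?fin ?rsummableN// mulrBr.
  - by move=> t _; rewrite -mulrBr maxrB.
  - by move=> t _; rewrite mulr_ge0 ?maxr0_ge0.
  - by move=> t _; rewrite mulr_ge0 ?maxr0_ge0.
  - exact: rsummableZ.
  - exact: rsummableZ.
(* A negative scalar exchanges the roles of the positive and negative parts. *)
have c0' : 0 <= - c by rewrite oppr_ge0 ltW.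
rewrite (@rsum_diff _ (fun t => - c * Num.max (- f t) 0) (fun t => - c * Num.max (f t) 0)).
- rewrite !ge0_esumZ// !fineM ?fin ?rsummableN//.
  by rewrite -mulrBr mulNr -mulrN opprB.
- by move=> t _; rewrite -mulrBr mulNr -mulrN opprB maxrB.
- by move=> t _; rewrite mulr_ge0 ?maxr0_ge0.
- by move=> t _; rewrite mulr_ge0 ?maxr0_ge0.
- exact: rsummableZ.
- exact: rsummableZ.
Qed.

End RealSums.

Section ComplexSums.
Variables (R : realType) (T : choiceType) (D : set T).
Implicit Types f g : T -> R[i].

Lemma cReD (z w : R[i]) : complex.Re (z + w) = complex.Re z + complex.Re w.
Proof. by case: z; case: w. Qed.

Lemma cImD (z w : R[i]) : complex.Im (z + w) = complex.Im z + complex.Im w.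
Proof. by case: z; case: w. Qed.

Lemma cReM (z w : R[i]) : complex.Re (z * w) =
  complex.Re z * complex.Re w - complex.Im z * complex.Im w.
Proof. by case: z; case: w. Qed.

Lemma cImM (z w : R[i]) : complex.Im (z * w) =
  complex.Re z * complex.Im w + complex.Im z * complex.Re w.
Proof. by case: z; case: w. Qed.

Lemma complex_eq (z w : R[i]) : complex.Re z = complex.Re w ->
  complex.Im z = complex.Im w -> z = w.
Proof. by case: z; case: w => /= a b c d -> ->. Qed.

Lemma csummable_eq f g : (forall t, D t -> f t = g t) -> csummable D g -> csummable D f.
Proof.
move=> fg [s1 s2].
by split; [apply: rsummable_eq s1|apply: rsummable_eq s2] => t /fg ->.
Qed.

Lemma csum_eq f g : (forall t, D t -> f t = g t) -> csum D f = csum D g.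
Proof. by move=> fg; congr Complex; apply: rsum_eq => t /fg ->. Qed.

Lemma csummable0 : csummable D (fun=> 0 : R[i]).
Proof. by split; exact: rsummable0. Qed.

Lemma csummableD f g : csummable D f -> csummable D g ->
  csummable D (fun t => f t + g t).
Proof.
move=> [f1 f2] [g1 g2]; split.
  by apply: rsummable_eq (rsummableD f1 g1) => t _; rewrite cReD.
by apply: rsummable_eq (rsummableD f2 g2) => t _; rewrite cImD.
Qed.

Lemma csumD f g : csummable D f -> csummable D g ->
  csum D (fun t => f t + g t) = csum D f + csum D g.
Proof.
move=> [f1 f2] [g1 g2]; apply: complex_eq; rewrite ?cReD ?cImD /=.
  by rewrite -rsumD//; apply: rsum_eq => t _; rewrite cReD.
by rewrite -rsumD//; apply: rsum_eq => t _; rewrite cImD.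
Qed.

Lemma csummableZ c f : csummable D f -> csummable D (fun t => c * f t).
Proof.
move=> [f1 f2]; split.
  apply: rsummable_eq (rsummableD (rsummableZ (complex.Re c) f1)
    (rsummableZ (- complex.Im c) f2)) => t _.
  by rewrite cReM mulNr.
apply: rsummable_eq (rsummableD (rsummableZ (complex.Re c) f2)
  (rsummableZ (complex.Im c) f1)) => t _.
by rewrite cImM.
Qed.

Lemma csumZ c f : csummable D f -> csum D (fun t => c * f t) = c * csum D f.
Proof.
move=> [f1 f2]; apply: complex_eq; rewrite ?cReM ?cImM /=.
  rewrite -mulNr -(rsumZ _ f1) -(rsumZ _ f2) -rsumD; try exact: rsummableZ.
  by apply: rsum_eq => t _; rewrite cReM mulNr.
rewrite -(rsumZ _ f1) -(rsumZ _ f2) -rsumD; try exact: rsummableZ.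
by apply: rsum_eq => t _; rewrite cImM.
Qed.

Lemma csum_sum (J : Type) (r : seq J) (P : pred J) (f : J -> T -> R[i]) :
  (forall j, P j -> csummable D (f j)) ->
  csummable D (fun t => \sum_(j <- r | P j) f j t) /\
  csum D (fun t => \sum_(j <- r | P j) f j t) = \sum_(j <- r | P j) csum D (f j).
Proof.
move=> sf; elim: r => [|j r [IHs IHe]].
  split; first by apply: csummable_eq csummable0 => t _; rewrite big_nil.
  rewrite big_nil (@csum_eq _ (fun t => 0 * 0)) => [|t _]; last by rewrite big_nil mul0r.
  by rewrite csumZ ?mul0r//; exact: csummable0.
rewrite big_cons; case: ifP => Pj; last first.
  by split; [apply: csummable_eq IHs|rewrite -IHe; apply: csum_eq] => t _;
    rewrite big_cons Pj.
split.
  by apply: csummable_eq (csummableD (sf j Pj) IHs) => t _; rewrite big_cons Pj.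
rewrite -IHe -csumD//; last exact: sf.
by apply: csum_eq => t _; rewrite big_cons Pj.
Qed.

End ComplexSums.

(** * Integrals of functions constant on countably many pieces *)

Section PiecewiseConstant.
Variables (R : realType) (d : measure_display) (T : measurableType d).
Variable mu : {measure set T -> \bar R}.
Hypothesis mufin : (mu setT < +oo)%E.
Variables (J : countType) (D0 : set J) (P : J -> set T).
Hypothesis mP : forall j, D0 j -> measurable (P j).
Hypothesis tP : trivIset D0 P.

(** The pieces renumbered by their codes, so that countable additivity for sequences applies;
    numbers that code no piece get the empty set. *)
Definition seq_piece (m : nat) : set T :=
  if choice.pickle_inv m is Some j then (if j \in D0 then P j else set0) else set0.

Lemma seq_piece_pickle j : D0 j -> seq_piece (choice.pickle j) = P j.
Proof. by move=> Dj; rewrite /seq_piece choice.pickleK_inv mem_set. Qed.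

Lemma seq_pieceP m x : seq_piece m x -> exists j, [/\ D0 j, P j x & m = choice.pickle j].
Proof.
rewrite /seq_piece; have := @choice.pickle_invK J m; case: choice.pickle_inv => //= j <-.
by case: ifP => //; rewrite inE => Dj Pj; exists j.
Qed.

Lemma measurable_seq_piece m : measurable (seq_piece m).
Proof.
rewrite /seq_piece; case: choice.pickle_inv => // j.
by case: ifP => //; rewrite inE => /mP.
Qed.

Lemma trivIset_seq_piece : trivIset setT seq_piece.
Proof.
move=> m m' _ _ [x [/seq_pieceP[j [Dj Pj ->]] /seq_pieceP[j' [Dj' Pj' ->]]]].
by congr choice.pickle; apply: tP => //; exists x.
Qed.

Lemma piecewise_measurable (h : T -> R) (c : J -> R) :
  (forall j x, D0 j -> P j x -> h x = c j) ->
  (forall x, h x != 0 -> exists j, D0 j /\ P j x) ->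
  measurable_fun setT h.
Proof.
move=> hP h0 _ Y mY; rewrite setTI.
pose A := \bigcup_(m in [set m | exists j, [/\ D0 j, m = choice.pickle j & Y (c j)]])
  seq_piece m.
(* Off the pieces the function is 0, so their complement belongs to the preimage exactly when [Y]
   contains 0. *)
pose B := if 0 \in Y then ~` \bigcup_m seq_piece m else set0.
have -> : h @^-1` Y = A `|` B.
  apply/seteqP; split=> x /=.
    move=> Yx; have [[j [Dj Pj]]|no] := pselect (exists j, D0 j /\ P j x).
      left; exists (choice.pickle j); last by rewrite seq_piece_pickle.
      by exists j; rewrite -(hP j x).
    have hx0 : h x = 0 by apply/eqP; apply: contra_notT no => /h0.
    right; rewrite /B -hx0 mem_set// => -[m _ /seq_pieceP[j [Dj Pj _]]].
    by apply: no; exists j.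
  move=> [[_ [j [Dj -> Yc]]]|].
    by rewrite seq_piece_pickle// => Pj; rewrite (hP j).
  rewrite /B; case: ifP => //; rewrite inE => Y0 no.
  suff -> : h x = 0 by [].
  apply/eqP; apply: contra_notT no => /h0[j [Dj Pj]].
  by exists (choice.pickle j) => //; rewrite seq_piece_pickle.
apply: measurableU.
  by apply: bigcup_measurable => m _; exact: measurable_seq_piece.
rewrite /B; case: ifP => // _; apply: measurableC.
by apply: bigcupT_measurable; exact: measurable_seq_piece.
Qed.

Let muP_fin j : D0 j -> mu (P j) \is a fin_num.
Proof.
move=> Dj; rewrite ge0_fin_numE//; apply: le_lt_trans mufin.
by apply: le_measure; rewrite ?inE//; exact: mP.
Qed.

Lemma piecewise_ge0_integral (h : T -> R) (c : J -> R) :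
  (forall j x, D0 j -> P j x -> h x = c j) ->
  (forall x, h x != 0 -> exists j, D0 j /\ P j x) ->
  (forall x, 0 <= h x) -> (forall j, 0 <= c j) ->
  (\int[mu]_x (h x)%:E = \esum_(j in D0) (c j * fine (mu (P j)))%:E)%E.
Proof.
move=> hP h0 hge0 cge0; have mh := piecewise_measurable hP h0.
have -> : (\int[mu]_x (h x)%:E = \int[mu]_(x in \bigcup_m seq_piece m) (h x)%:E)%E.
  rewrite [RHS]integral_mkcond; apply: eq_integral => x _; rewrite patchE.
  case: ifPn => //; rewrite notin_setE => no; congr (_%:E).
  apply/eqP; apply: contra_notT no => /h0[j [Dj Pj]].
  by exists (choice.pickle j) => //; rewrite seq_piece_pickle.
rewrite ge0_integral_bigcup//; last 4 first.
- exact: measurable_seq_piece.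
- by apply: measurable_funTS; apply/measurable_EFinP.
- by move=> x _; rewrite lee_fin.
- exact: trivIset_seq_piece.
rewrite nneseries_esumT; last by move=> m; apply: integral_ge0 => x _; rewrite lee_fin.
rewrite (_ : \esum_(m in setT) _ = \esum_(m in choice.pickle @` D0)
   (\int[mu]_(x in seq_piece m) (h x)%:E))%E; last first.
  rewrite [RHS]esum_mkcond; apply: eq_esum => m _; case: ifPn => //.
  rewrite notin_setE => no; rewrite (_ : seq_piece m = set0) ?integral_set0//.
  apply/seteqP; split=> // x /seq_pieceP[j [Dj _ mj]]; apply: no.
  by exists j.
rewrite (reindex_esum D0 _ choice.pickle)//; last first.
  apply: inj_bij => i j _ _ e; apply: Some_inj.
  by rewrite -(@choice.pickleK_inv J i) e choice.pickleK_inv.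
apply: eq_esum => j Dj; rewrite seq_piece_pickle//.
rewrite (eq_integral (cst (c j)%:E)); last first.
  by move=> x; rewrite inE => Pj; rewrite (hP j).
by rewrite integral_cst ?EFinM ?fineK ?muP_fin//; exact: mP.
Qed.

(** All work is done on [g], the extension of [f] by zero outside [D], whose measurability comes
    from the pieces. Values bounded by 1 on a space of finite measure give integrability, and the
    integral of the absolute value is the sum of absolute values of the series. *)
Lemma piecewise_integral (D : set T) (f : T -> R) (v : J -> R) :
  (forall j x, D0 j -> P j x -> D x /\ f x = v j) ->
  (forall x, D x -> f x != 0 -> exists j, D0 j /\ P j x) ->
  (forall j, `|v j| <= 1) ->
  [/\ rsummable D0 (fun j => v j * fine (mu (P j))),
      mu.-integrable D (fun x => (f x)%:E) &
      \int[mu]_(x in D) f x = rsum D0 (fun j => v j * fine (mu (P j)))].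
Proof.
move=> fP f0 v1; pose g := patch (fun=> 0) D f.
have gE x : patch (fun=> 0%E) D (fun x => (f x)%:E) x = (g x)%:E.
  by rewrite /g !patchE; case: ifP.
have gP j x : D0 j -> P j x -> g x = v j.
  by move=> Dj Pj; have [Dx fx] := fP j x Dj Pj; rewrite /g patchE mem_set.
have g0 x : g x != 0 -> exists j, D0 j /\ P j x.
  rewrite /g patchE; case: ifP => [|_]; last by rewrite eqxx.
  by rewrite inE; exact: f0.
have mg := piecewise_measurable gP g0.
(* Used with [u] the absolute value, the positive part and the negative part. *)
have comp (u : R -> R) : u 0 = 0 -> (forall x, 0 <= u x) ->
    (\int[mu]_x (u (g x))%:E =
     \esum_(j in D0) (u (v j) * fine (mu (P j)))%:E)%E.
  move=> u0 uge0; apply: piecewise_ge0_integral => //.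
    by move=> j x Dj Pj; rewrite (gP j).
  by move=> x ux; apply: g0; apply: contra_neq ux => ->.
have abs_fin : (\int[mu]_x (`|g x|)%:E < +oo)%E.
  apply: le_lt_trans mufin; rewrite -[leRHS]mul1e -integral_cst//.
  apply: ge0_le_integral => //.
  - by apply/measurable_EFinP; apply: measurableT_comp.
  - move=> x _; rewrite lee_fin; have [->|/g0[j [Dj Pj]]] := eqVneq (g x) 0.
      by rewrite normr0.
    by rewrite (gP j).
have muge0 j : 0 <= fine (mu (P j)) by exact: fine_ge0.
have sv : rsummable D0 (fun j => v j * fine (mu (P j))).
  rewrite /rsummable /summable; apply: le_lt_trans abs_fin.
  rewrite (comp (fun x => `|x|)) ?normr0//; apply: le_esum => j _ /=.
  by rewrite lee_fin normrM (ger0_norm (muge0 j)).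
split=> //.
  apply/integrableP; split.
    move=> mD; have := (measurable_restrict (fun x => (f x)%:E) mD measurableT).2.
    rewrite setTI; apply => //.
    rewrite (_ : patch _ _ _ = EFin \o g); first exact/measurable_EFinP.
    by apply/funext => x; rewrite gE.
  rewrite integral_mkcond; move: abs_fin; congr (_ < _)%E.
  apply: eq_integral => x _; rewrite /g !patchE; case: ifP => //.
  by rewrite normr0.
rewrite /Rintegral integral_mkcond integralE.
under eq_integral do rewrite funeposE gE -EFin_max.
under [X in (_ - X)%E]eq_integral do rewrite funenegE gE -EFinN -EFin_max.
rewrite (comp (fun x => Num.max x 0)) ?maxxx//; last by move=> x; exact: maxr0_ge0.
rewrite (comp (fun x => Num.max (- x) 0)) ?oppr0 ?maxxx//; last by move=> x; exact: maxr0_ge0.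
rewrite /rsum -fineB; last 2 first.
- apply: ge0_rsummable; first by move=> j _; exact: maxr0_ge0.
  exact: rsummable_max.
- apply: ge0_rsummable; first by move=> j _; exact: maxr0_ge0.
  exact/rsummable_max/rsummableN.
congr fine; congr (_ - _)%E; apply: eq_esum => j _.
  by rewrite maxr_pMl// mul0r.
by rewrite maxr_pMl// mul0r mulNr.
Qed.

End PiecewiseConstant.

(** * Comparison of the two sides *)

Section ComplexPowers.
Variable R : realType.
Implicit Types (a : R) (z w : R[i]).

Lemma cReN z : complex.Re (- z) = - complex.Re z. Proof. by case: z. Qed.
Lemma cImN z : complex.Im (- z) = - complex.Im z. Proof. by case: z. Qed.

Lemma natC m : m%:R = real_complex R m%:R :> R[i].
Proof. by rewrite rmorph_nat. Qed.

Lemma Re_natM m z : complex.Re (m%:R * z) = m%:R * complex.Re z.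
Proof. by rewrite natC cReM /= mul0r subr0. Qed.

Lemma Im_natM m z : complex.Im (m%:R * z) = m%:R * complex.Im z.
Proof. by rewrite natC cImM /= mul0r addr0. Qed.

Lemma Re_nat m : complex.Re (m%:R : R[i]) = m%:R.
Proof. by rewrite natC. Qed.

Lemma cpow0r a : a != 0 -> cpow a 0 = 1.
Proof.
by move=> /negPf a0; rewrite /cpow a0 /= !mul0r expR0 cos0 sin0 mulr1 mulr0.
Qed.

Lemma cpowD a z w : a != 0 -> cpow a (z + w) = cpow a z * cpow a w.
Proof.
move=> /negPf a0; rewrite /cpow a0 cReD cImD !mulrDl expRD cosD sinD.
by apply: complex_eq; rewrite ?cReM ?cImM /=; ring.
Qed.

Lemma cpow_sum (J : Type) (r : seq J) (P : pred J) (F : J -> R[i]) a : a != 0 ->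
  cpow a (\sum_(j <- r | P j) F j) = \prod_(j <- r | P j) cpow a (F j).
Proof.
move=> a0; apply: (big_morph (cpow a)) => [x y|]; [exact: cpowD|exact: cpow0r].
Qed.

Lemma cpow_expV a m z : 0 < a -> cpow (a^-1 ^+ m) z = cpow a (- (m%:R * z)).
Proof.
move=> a0; have am0 : 0 < a^-1 ^+ m by rewrite exprn_gt0 ?invr_gt0.
rewrite /cpow !gt_eqF// cReN cImN Re_natM Im_natM.
have -> : ln (a^-1 ^+ m) = - (m%:R * ln a).
  by rewrite lnXn ?invr_gt0// lnV ?posrE// mulNrn mulr_natl.
have e x : x * - (m%:R * ln a) = - (m%:R * x) * ln a by ring.
by rewrite !e.
Qed.

Lemma cpow_natN a m : 0 < a -> cpow a (- m%:R) = real_complex R (a^-1 ^+ m).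
Proof.
move=> a0; rewrite -[m%:R]mulr1 -cpow_expV//.
have am0 : 0 < a^-1 ^+ m by rewrite exprn_gt0 ?invr_gt0.
rewrite /cpow gt_eqF//= mul0r cos0 sin0 mulr1 mulr0 mul1r lnK//.
Qed.

Lemma cpow_bound a z : 1 <= a -> complex.Re z <= 0 ->
  `|complex.Re (cpow a z)| <= 1 /\ `|complex.Im (cpow a z)| <= 1.
Proof.
move=> a1 z0; rewrite /cpow gt_eqF ?(lt_le_trans ltr01)//=.
have e1 : expR (complex.Re z * ln a) <= 1.
  by rewrite -expR0 ler_expR mulr_le0_ge0// ln_ge0.
have e0 := expR_ge0 (complex.Re z * ln a).
by rewrite !normrM (ger0_norm e0); split;
  rewrite mulr_ile1// ler_norml ?cos_geN1 ?cos_le1 ?sin_geN1 ?sin_le1.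
Qed.

End ComplexPowers.

Section Integrand.
Variables (R : realType) (o : topIdomainType) (pi : o) (ho : is_compact_dvr pi).
Variables (k : finFieldType) (red : {rmorphism o -> k}).
Hypothesis hred : is_residue_map pi red.
Variables (n : nat) (I : {set 'I_n}).
Hypothesis hI : forall i, i \in I -> (0 < i)%N.
Local Notation q := (#|k|%:R : R).
Let hd : is_dvr pi := cdvr_dvr ho.

Lemma q_gt0 : 0 < q. Proof. exact: lt_trans (q_gt1 k R). Qed.

Let unit_parts (a u v b c : o) : a * u * (v * b) * c = (u * v) * (a * b * c).
Proof. by rewrite [a * u]mulrC mulrACA -!mulrA. Qed.

(** On a sphere, [pi * x_iota] is [pi ^+ t.2 iota] times a unit and [x_0] is [pi ^+ t.1] times a
    unit. Units do not affect divisibility, and what remains is the criterion of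
    [mul_closed_latticeP]. *)
Lemma in_M_sphere (t : nat * {ffun Idx I -> nat}) (x : Xspace I o) (B : 'M[o]_n) :
  (forall iota, (0 < t.2 iota)%N) -> sphere pi t x ->
  @in_M n I o pi x.1 x.2 B <-> in_L I B /\ mul_closed (lattice pi t.1 t.2 B).
Proof.
move=> t1 [x0 v0 hx].
have [u0 Uu0 x0E] := valdP hd x0; rewrite v0 in x0E.
have ex iota : exists u, u \is a GRing.unit /\ pi * x.2 iota = pi ^+ t.2 iota * u.
  have [xn0 vx] := hx iota; have [u Uu xE] := valdP hd xn0; exists u; split=> //.
  by rewrite xE vx mulrA -exprS prednK.
pose u iota := projT1 (cid (ex iota)).
have Uu iota : u iota \is a GRing.unit by rewrite /u; case: cid => ? [].
have uE iota : pi * x.2 iota = pi ^+ t.2 iota * u iota by rewrite /u; case: cid => ? [].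
have prodE (P : pred (Idx I)) : \prod_(iota | P iota) (pi * x.2 iota) =
    (\prod_(iota | P iota) u iota) * pi ^+ (\sum_(iota | P iota) t.2 iota).
  rewrite (eq_bigr (fun iota => u iota * pi ^+ t.2 iota)) => [|iota _].
    by rewrite big_split/= prodrXr.
  by rewrite uE mulrC.
have Uprod (P : pred (Idx I)) : \prod_(iota | P iota) u iota \is a GRing.unit.
  by apply: rpred_prod => iota _.
have UU (P : pred (Idx I)) : u0 * \prod_(iota | P iota) u iota \is a GRing.unit.
  by rewrite unitrM Uu0 Uprod.
rewrite /in_M; split=> -[LB H]; split=> //.
  apply/(mul_closed_latticeP hd t.1 t.2 LB) => j i i' ji ii'.
  have := H j i i' ji ii'; rewrite !prodE rdivides_unitl//.
  rewrite x0E.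
  rewrite (_ : _ * u0 * _ * _ = (u0 * \prod_(iota | (i' < inat iota)%N) u iota) *
    (pi ^+ t.1 * pi ^+ dwt t.2 i' *
      \sum_(l < n | (l <= i)%N) B i l * B i' l * invmx B l j)); last exact: unit_parts.
  by move/(rdivides_unitr _ _ (UU (fun iota => (i' < inat iota)%N))).
move=> j i i' ji ii'; have := (mul_closed_latticeP hd t.1 t.2 LB).1 H j i i' ji ii'.
rewrite !prodE rdivides_unitl// x0E.
rewrite [X in _ -> rdivides _ X](_ : _ = (u0 * \prod_(iota | (i' < inat iota)%N) u iota) *
    (pi ^+ t.1 * pi ^+ dwt t.2 i' *
      \sum_(l < n | (l <= i)%N) B i l * B i' l * invmx B l j)); last exact: unit_parts.
by move=> h; apply/(rdivides_unitr _ _ (UU (fun iota => (i' < inat iota)%N))).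
Qed.

Definition integrand_exp (s0 : R[i]) (s : Idx I -> R[i])
    (t : nat * {ffun Idx I -> nat}) : R[i] :=
  - (t.1%:R * (s0 * n%:R - 1)) - \sum_(iota : Idx I)
      (t.2 iota).-1%:R * ((inat iota)%:R * (s iota - (n%:R - (inat iota)%:R)) - 1).

Lemma integrand_sphere (s0 : R[i]) (s : Idx I -> R[i]) t
    (z : Xspace I o * Bspace n o) : sphere pi t z.1 ->
  integrand pi #|k| s0 s z = cpow q (integrand_exp s0 s t).
Proof.
have q0 : q != 0 by rewrite gt_eqF// q_gt0.
move=> [x0 v0 hx]; rewrite /integrand /integrand_exp [RHS]cpowD// -sumrN cpow_sum//.
rewrite /absd (negPf x0) v0 cpow_expV ?q_gt0//; congr (_ * _).
apply: eq_bigr => iota _; have [xn0 vx] := hx iota.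
by rewrite (negPf xn0) vx cpow_expV ?q_gt0.
Qed.

Lemma integrand_neq0 (s0 : R[i]) (s : Idx I -> R[i]) (z : Xspace I o * Bspace n o) :
  integrand pi #|k| s0 s z != 0 -> z.1.1 != 0 /\ forall iota, z.1.2 iota != 0.
Proof.
have abs0 : absd R pi #|k| 0 = 0 by rewrite /absd eqxx.
rewrite /integrand mulf_eq0 negb_or => /andP[h1 h2]; split.
  by apply: contraNneq h1 => ->; rewrite abs0 /cpow eqxx.
move=> iota; apply: contraNneq h2 => x0.
by rewrite (bigD1 iota)//= x0 abs0 /cpow eqxx mul0r.
Qed.

(** Real parts above n make every exponent of an |x_i| nonnegative: n Re s_0 is at least 1, and iota
    (Re s - n + iota) is at least 1 because iota is. Hence the integrand is bounded. *)
Lemma Re_integrand_exp (s0 : R[i]) (s : Idx I -> R[i]) t : (0 < n)%N -> n%:R < complex.Re s0 ->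
  (forall iota, n%:R < complex.Re (s iota)) ->
  complex.Re (integrand_exp s0 s t) <= 0.
Proof.
move=> n0 hs0 hs.
have n1 : 1 <= n%:R :> R by rewrite ler1n.
have Re_sum (F : Idx I -> R[i]) : complex.Re (\sum_iota F iota) = \sum_iota complex.Re (F iota).
  by apply: (big_morph (@complex.Re R)) => //; exact: cReD.
rewrite /integrand_exp -opprD cReN oppr_le0 cReD Re_sum addr_ge0//.
  by rewrite Re_natM mulr_ge0// [s0 * _]mulrC cReD cReN Re_natM /=; nra.
apply: sumr_ge0 => iota _; rewrite Re_natM mulr_ge0//.
rewrite !(cReD, cReN, Re_natM, Re_nat) /=.
have := hs iota; have : 1 <= (inat iota)%:R :> R by rewrite ler1n hI// (valP iota).
move=> h1 h2; nra.
Qed.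

(** The four terms on the right are the prefactor, the value of the integrand, the sphere volume and
    the coset volume. Writing r = (r - 1) + 1 splits off the prefactor; the summands -1 in the
    exponents cancel the sphere volume, and the terms iota (n - iota) cancel the coset volume. *)
Lemma Xi_exponent (s0 : R[i]) (s : Idx I -> R[i]) (t : nat * {ffun Idx I -> nat}) :
  (forall iota, (0 < t.2 iota)%N) ->
  - (s0 * n%:R * t.1%:R) - \sum_(iota : Idx I) (t.2 iota)%:R * (inat iota)%:R * s iota =
  - (\sum_(iota : Idx I) (inat iota)%:R * (s iota - n%:R + (inat iota)%:R))
  + integrand_exp s0 s t - (t.1 + \sum_iota (t.2 iota).-1)%N%:R
  - (\sum_iota t.2 iota * (inat iota * (n - inat iota)))%N%:R :> R[i].
Proof.
move=> t1; rewrite /integrand_exp natrD !natr_sum.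
rewrite [RHS](_ : _ = - (s0 * n%:R * t.1%:R) -
  (\sum_(iota : Idx I) (inat iota)%:R * (s iota - n%:R + (inat iota)%:R)
   + \sum_(iota : Idx I) (t.2 iota).-1%:R *
       ((inat iota)%:R * (s iota - (n%:R - (inat iota)%:R)) - 1)
   + \sum_iota (t.2 iota).-1%:R + \sum_iota (t.2 iota * (inat iota * (n - inat iota)))%N%:R));
  last by ring.
congr (_ - _); rewrite -!big_split/=; apply: eq_bigr => iota _.
rewrite !natrM natrB; last exact: ltnW (ltn_ord (val iota)).
have -> : (t.2 iota)%:R = (t.2 iota).-1%:R + 1 :> R[i] by rewrite natr1 prednK.
ring.
Qed.

End Integrand.

(** Meant for [v] the power of 1 - q^-1 in the sphere volume, which the Dirichlet term lacks and the
    prefactor divides out. *)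
Lemma cancel_volume (F : fieldType) (W x y t N v : F) : v != 0 ->
  W * (x * (y * (t * N))) = v^-1 * (t * (x * v * (N * y) * W)).
Proof. by move=> v0; field. Qed.

Section XiIntegral.
Variables (R : realType) (o : topIdomainType) (pi : o) (ho : is_compact_dvr pi).
Variables (k : finFieldType) (red : {rmorphism o -> k}).
Hypothesis hred : is_residue_map pi red.
Variables (n : nat) (I : {set 'I_n}).
Hypothesis hI : forall i, i \in I -> (0 < i)%N.
Hypothesis hn : (0 < n)%N.
Variables (mux : probability (Xspace I o) R) (muB : probability (Bspace n o) R).
Hypothesis hmux : is_haar (@Xadd n I o) [set: Xspace I o] mux.
Hypothesis hmuB :
  is_haar (@Bmul n o) [set B : Bspace n o | in_L I (B : 'M[o]_n)] muB.
Local Notation q := (#|k|%:R : R).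
Local Notation C := (real_complex R).
Let hd : is_dvr pi := cdvr_dvr ho.

Definition piece (E : 'M[k]_n) (t : nat * {ffun Idx I -> nat}) :
    set (Xspace I o * Bspace n o) :=
  sphere pi t `*` subalg_rep pi red t.1 t.2 E.

Definition sphere_vol (t : nat * {ffun Idx I -> nat}) : R :=
  q^-1 ^+ (t.1 + \sum_iota (t.2 iota).-1) * (1 - q^-1) ^+ (#|I| + 1).

Definition rep_vol (E : 'M[k]_n) (t : nat * {ffun Idx I -> nat}) : R :=
  (lattice_count pi red t.1 t.2 E)%:R *
  q^-1 ^+ (\sum_iota t.2 iota * (inat iota * (n - inat iota))).

Lemma piece_measure E t : Xi_dom t -> measurable (piece E t) /\
  (mux \x muB)%E (piece E t) = (sphere_vol t * rep_vol E t)%:E.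
Proof.
move=> t1; have [mS muS] := sphere_measure ho hred hmux t.
have [mC muC] := subalg_rep_measure ho hred hmuB t.1 E t1.
split; first exact: measurableX.
transitivity (mux (sphere pi t) * muB (subalg_rep pi red t.1 t.2 E))%E.
  exact: product_measure1E.
rewrite muS muC -EFinM; congr (_ * _)%:E.
rewrite big_split/= prodrXr /sphere_vol exprD mulrACA; congr (_ * _).
rewrite prodr_const -exprS addn1; congr (_ ^+ _.+1).
by rewrite card_sig; apply: eq_card => i; rewrite !inE.
Qed.

Lemma piece_trivIset E : trivIset (@Xi_dom n I) (piece E).
Proof.
move=> [r0 r] [r0' r'] /= r1 r1' [z [[[_ /= v0 h] _] [[_ /= v0' h'] _]]].
rewrite -v0 -v0'; congr pair; apply/ffunP => iota.
have [_ /= e] := h iota; have [_ /= e'] := h' iota.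
by rewrite -(prednK (r1 iota)) -(prednK (r1' iota)) -e -e'.
Qed.

Lemma piece_M_fiber E t z : Xi_dom t -> piece E t z -> M_fiber pi red E z.
Proof.
move=> t1 [Sz [LB rB cl]]; split=> //.
by apply/(in_M_sphere ho _ t1 Sz).
Qed.

Lemma M_fiber_piece E z : M_fiber pi red E z -> z.1.1 != 0 ->
  (forall iota, z.1.2 iota != 0) -> exists t, Xi_dom t /\ piece E t z.
Proof.
move=> [Mz rB] x0 hx.
pose t : nat * {ffun Idx I -> nat} :=
  (vald pi z.1.1, [ffun iota => (vald pi (z.1.2 iota)).+1]).
have t1 : Xi_dom t by move=> iota; rewrite /= ffunE.
have Sz : sphere pi t z.1 by split=> // iota; rewrite /= ffunE.
exists t; split=> //; split=> //.
by have [LB cl] := (in_M_sphere ho _ t1 Sz).1 Mz.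
Qed.

Lemma product_measure_fin : ((mux \x muB)%E setT < +oo)%E.
Proof.
have -> : ((mux \x muB)%E setT = mux setT * muB setT)%E.
  by rewrite -setXTT; exact: product_measure1E.
by rewrite !probability_setT mule1 ltry.
Qed.

Section Convergence.
Variables (s0 : R[i]) (s : Idx I -> R[i]).
Hypothesis hs0 : n%:R < complex.Re s0.
Hypothesis hs : forall iota, n%:R < complex.Re (s iota).

Let w := @integrand_exp R n I s0 s.

Definition piece_term (E : 'M[k]_n) (t : nat * {ffun Idx I -> nat}) : R[i] :=
  C (sphere_vol t * rep_vol E t) * cpow q (w t).

Lemma fiber_integral E :
  [/\ csummable (@Xi_dom n I) (piece_term E),
      cintegrable (mux \x muB)%E (M_fiber pi red E) (integrand pi #|k| s0 s) &
      cintegral (mux \x muB)%E (M_fiber pi red E) (integrand pi #|k| s0 s) =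
      csum (@Xi_dom n I) (piece_term E)].
Proof.
have mP t : Xi_dom t -> measurable (piece E t) by move=> /(piece_measure E)[].
(* Here [u] stands for the real or the imaginary part. *)
have part (u : R[i] -> R) : u 0 = 0 -> (forall t, `|u (cpow q (w t))| <= 1) ->
    [/\ rsummable (@Xi_dom n I)
          (fun t => u (cpow q (w t)) * fine ((mux \x muB)%E (piece E t))),
        (mux \x muB)%E.-integrable (M_fiber pi red E)
          (fun z => (u (integrand pi #|k| s0 s z))%:E) &
        \int[(mux \x muB)%E]_(z in M_fiber pi red E) u (integrand pi #|k| s0 s z) =
        rsum (@Xi_dom n I)
          (fun t => u (cpow q (w t)) * fine ((mux \x muB)%E (piece E t)))].
  move=> u0 u1; apply: (piecewise_integral product_measure_fin mP (@piece_trivIset E)).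
  - move=> t z Dt Pz; split; first exact: piece_M_fiber Pz.
    by case: Pz => Sz _; rewrite (integrand_sphere k s0 s Sz).
  - move=> z Mz uz; have : integrand pi #|k| s0 s z != 0.
      by apply: contra_neq uz => ->.
    by move=> /integrand_neq0[]; exact: M_fiber_piece.
  - exact: u1.
have Re0 t : complex.Re (w t) <= 0 by exact: Re_integrand_exp.
have b t := cpow_bound (ltW (q_gt1 k R)) (Re0 t).
have [s1 i1 e1] := part (@complex.Re R) erefl (fun t => (b t).1).
have [s2 i2 e2] := part (@complex.Im R) erefl (fun t => (b t).2).
have ReE t : Xi_dom t -> complex.Re (piece_term E t) =
    complex.Re (cpow q (w t)) * fine ((mux \x muB)%E (piece E t)).
  move=> Dt; rewrite /piece_term cReM /= mul0r subr0 mulrC.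
  by rewrite (piece_measure E Dt).2.
have ImE t : Xi_dom t -> complex.Im (piece_term E t) =
    complex.Im (cpow q (w t)) * fine ((mux \x muB)%E (piece E t)).
  move=> Dt; rewrite /piece_term cImM /= mul0r addr0 mulrC.
  by rewrite (piece_measure E Dt).2.
split=> //.
  by split; [apply: rsummable_eq s1|apply: rsummable_eq s2].
apply: complex_eq => /=; first by rewrite e1; apply/esym/rsum_eq.
by rewrite e2; apply/esym/rsum_eq.
Qed.

Lemma Xi_term_pieces t : Xi_dom t -> Xi_term pi #|k| s0 s t =
  cpow q (- \sum_(iota : Idx I) (inat iota)%:R * (s iota - n%:R + (inat iota)%:R))
  / (1 - #|k|%:R^-1) ^+ (#|I| + 1) *
  \sum_(E : 'M[k]_n | in_L I E) (tau I E)%:R * piece_term E t.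
Proof.
move=> t1; have q0 := q_gt0 R k; have qn0 : q != 0 by rewrite gt_eqF.
have q1 : 1 - q^-1 != 0.
  by rewrite subr_eq0 eq_sym invr_eq1 gt_eqF// q_gt1.
have KE : (1 - C q^-1) ^+ (#|I| + 1) = C ((1 - q^-1) ^+ (#|I| + 1)).
  by rewrite rmorphXn rmorphB rmorph1.
rewrite (natC R #|k|) -(fmorphV C) KE /Xi_term (Xi_exponent _ _ t1) /piece_term /w.
move: (integrand_exp s0 s t) => z.
rewrite !(cpowD _ _ qn0) !cpow_natN//.
rewrite (hcount_sum hd hred t.1 t1) natr_sum -!mulrA; congr (_ * _).
rewrite !mulr_sumr; apply: eq_bigr => E _.
rewrite /sphere_vol /rep_vol natrM.
rewrite !(rmorphM C) (natC R (lattice_count _ _ _ _ _)).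
by apply: cancel_volume; rewrite fmorph_eq0 expf_neq0.
Qed.

End Convergence.
End XiIntegral.

Theorem mainTheorem8 (R : realType)
    (o : topIdomainType) (pi : o) (ho : is_compact_dvr pi)
    (k : finFieldType) (red : {rmorphism o -> k}) (hred : is_residue_map pi red)
    (n : nat) (hn : (2 <= n)%N)
    (I : {set 'I_n}) (hI : forall i, i \in I -> (0 < i)%N) (hI0 : I != finset.set0)
    (mux : probability (Xspace I o) R)
    (hmux : is_haar (@Xadd n I o) [set: Xspace I o] mux)
    (muB : probability (Bspace n o) R)
    (hmuB : is_haar (@Bmul n o) [set B : Bspace n o | in_L I (B : 'M[o]_n)] muB) :
  exists c : R, forall (s0 : R[i]) (s : Idx I -> R[i]),
    c < complex.Re s0 -> (forall iota, c < complex.Re (s iota)) ->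
    [/\ csummable (@Xi_dom n I) (Xi_term pi #|k| s0 s),
        (forall E : 'M[k]_n, in_L I E ->
           cintegrable (mux \x muB)%E (M_fiber pi red E)
             (integrand pi #|k| s0 s))
      & Xi pi #|k| s0 s
        = cpow #|k|%:R
            (- \sum_(iota : Idx I)
                 (inat iota)%:R * (s iota - n%:R + (inat iota)%:R))
          / (1 - #|k|%:R^-1) ^+ (#|I| + 1)
          * \sum_(E : 'M[k]_n | in_L I E)
              (tau I E)%:R
              * cintegral (mux \x muB)%E (M_fiber pi red E)
                  (integrand pi #|k| s0 s)].
Proof.
(* The threshold n is the one that [Re_integrand_exp] needs to bound the integrand. *)
exists n%:R => s0 s hs0 hs; have n0 : (0 < n)%N by exact: ltnW.
have fib E := fiber_integral ho hred hI n0 hmux hmuB hs0 hs E.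
set K := cpow _ _ / _.
have XiE t : Xi_dom t -> Xi_term pi #|k| s0 s t =
    K * \sum_(E : 'M[k]_n | in_L I E) (tau I E)%:R * piece_term pi red s0 s E t.
  by move=> Dt; exact: Xi_term_pieces.
have sE E : in_L I E -> csummable (@Xi_dom n I)
    (fun t => (tau I E)%:R * piece_term pi red s0 s E t).
  by move=> _; apply: csummableZ; case: (fib E).
have [sS eS] := csum_sum (index_enum _) sE.
split.
(* The Dirichlet series is termwise a finite combination, over the residues E, of the series
   computing the integrals, and inherits their absolute convergence. *)
- by apply: csummable_eq XiE _; exact: csummableZ.
- by move=> E _; case: (fib E).
rewrite /Xi (csum_eq XiE) csumZ// eS; congr (_ * _); apply: eq_bigr => E _.
by have [s1 _ ->] := fib E; rewrite csumZ.
Qed.
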